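(* Let $p,q,r,a,b,c$ be even positive integers. Then the Conway polynomial of the knot $K\left(\begin{smallmatrix} p & q & r\\ a & b & c\end{smallmatrix}\right)$ is $$\nabla_{K\left(\begin{smallmatrix} p & q & r\\ a & b & c\end{smallmatrix}\right)}=(pq+pr+qr)(ab+ac+bc)\left(\frac z2\right)^4+(pa+pc+qa+qb+rb+rc)\left(\frac z2\right)^2+1.$$
   Context: Twist regions. Let $e$ be an arc (an edge) in $S^2$ with two disjoint strands running parallel to $e$, one on each side. To put the integer label $n$ on $e$ means to twist these two strands about $e$ by $|n|$ half twists, producing a row of $|n|$ crossings along $e$ (none if $n=0$), all of sign $\operatorname{sign}(n)$ relative to $e$. A crossing is positive relative to $e$ if, when the picture (with $S^2$ viewed from a fixed side) is rotated locally so that $e$ is vertical, the overcrossing strand runs from upper left to lower right; it is negative if the overcrossing strand runs from lower left to upper right. The diagram $K\left(\begin{smallmatrix} p & q & r\\ a & b & c\end{smallmatrix}\right)$, for integers $p,q,r,a,b,c$. Divide a circle $C\subset S^2$ into six arcs $A_1,B_1,A_2,B_2,A_3,B_3$ in this cyclic order. In one complementary disk of $C$ (the inside) take a Y-shaped tree $T$ with one trivalent vertex and three legs ending at interior points of $A_1,A_2,A_3$, and three disjoint strands forming the boundary of a thin neighborhood of $T$, the $i$-th strand joining the two endpoints of $B_i$; two strands run along each leg. Put labels $p,q,r$ on the legs ending at $A_1,A_2,A_3$, respectively. In the other disk (the outside) take a Y-shaped tree $T'$ with legs ending at interior points of $B_1,B_2,B_3$ and three strands forming the boundary of a thin neighborhood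 of $T'$, the $i$-th strand joining the two endpoints of $A_i$; put labels $a,b,c$ on the legs ending at $B_1,B_2,B_3$, respectively. The union is the link diagram $K\left(\begin{smallmatrix} p & q & r\\ a & b & c\end{smallmatrix}\right)$. When all six labels are even it presents a knot. $\nabla_K(z)$ is the Conway polynomial, with $\nabla=1$ for the unknot and $\nabla_{L_+}-\nabla_{L_-}=z\nabla_{L_0}$. *)

(* Defs.v *)
(* Link diagrams in the oriented sphere, encoded by planar-diagram codes. *)
From HB Require Import structures.
From mathcomp Require Import all_boot all_order all_algebra.
From mathcomp Require Import zify.

Set Implicit Arguments.
Unset Strict Implicit.
Unset Printing Implicit Defensive.

Import Order.TTheory GRing.Theory Num.Theory.

(* A diagram is cut into edges (named by natural numbers) at its crossings and
   at some auxiliary points, so every edge name occurs exactly twice.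
   [Cross a b c d] is a crossing whose four ends, read counterclockwise, are
   a, b, c, d; the ends a and c belong to the UNDERcrossing strand.
   [Point a b] is a point in the interior of a strand: it joins a to b. *)
Inductive vertex :=
  | Cross of nat & nat & nat & nat
  | Point of nat & nat.

Definition ends (v : vertex) : seq nat :=
  match v with
  | Cross a b c d => [:: a; b; c; d]
  | Point a b => [:: a; b]
  end.

(* The two codes of one and the same vertex differ by a half turn. *)
Definition same_vertex (v w : vertex) : bool :=
  match v, w with
  | Cross _ _ _ _, Cross _ _ _ _ => (ends v == ends w) || (rot 2 (ends v) == ends w)
  | Point _ _, Point _ _ => (ends v == ends w) || (rot 1 (ends v) == ends w)
  | _, _ => false
  end.

(* [disk V s]: the vertices with (counterclockwise) lists of ends V can be
   drawn in a disk without crossing edges, the ends that are not yet joined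
   reaching the boundary of the disk in the counterclockwise order s. *)
Inductive disk : seq (seq nat) -> seq nat -> Prop :=
  | disk_nil : disk [::] [::]
  | disk_vertex s : disk [:: s] s
  | disk_union V W s t : disk V s -> disk W t -> disk (V ++ W) (s ++ t)
  | disk_perm V W s : perm_eq V W -> disk V s -> disk W s
  | disk_rot n V s : disk V s -> disk V (rot n s)
  | disk_join e V s : disk V [:: e, e & s] -> disk V s.

(* Oriented vertices. [DCross s l r l' r'] is the crossing of sign s (true for
   positive) which, rotated so that both strands go upwards, has incoming ends
   l (lower left), r (lower right) and outgoing ends l' (upper left),
   r' (upper right); the strand from l to r' is the upper one iff s holds.
   [DPoint i o] has incoming end i and outgoing end o. *)
Inductive dvertex :=
  | DCross of bool & nat & nat & nat & nat
  | DPoint of nat & nat.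

Definition dvertex_code (v : dvertex) :=
  match v with
  | DCross s l r l' r' => inl (s, (l, r, (l', r')))
  | DPoint i o => inr (i, o)
  end.

Definition dvertex_decode (x : bool * (nat * nat * (nat * nat)) + nat * nat) :=
  match x with
  | inl (s, (l, r, (l', r'))) => DCross s l r l' r'
  | inr (i, o) => DPoint i o
  end.

Lemma dvertex_codeK : cancel dvertex_code dvertex_decode.
Proof. by case. Qed.

HB.instance Definition _ := Equality.copy dvertex (can_type dvertex_codeK).

Definition forget (v : dvertex) : vertex :=
  match v with
  | DCross true l r l' r' => Cross r r' l' l
  | DCross false l r l' r' => Cross l r r' l'
  | DPoint i o => Point i o
  end.

Definition ins (v : dvertex) : seq nat :=
  match v with DCross _ l r _ _ => [:: l; r] | DPoint i _ => [:: i] end.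

Definition outs (v : dvertex) : seq nat :=
  match v with DCross _ _ _ l' r' => [:: l'; r'] | DPoint _ o => [:: o] end.

Definition map_dvertex (f : nat -> nat) (v : dvertex) : dvertex :=
  match v with
  | DCross s l r l' r' => DCross s (f l) (f r) (f l') (f r')
  | DPoint i o => DPoint (f i) (f o)
  end.

(* Every edge has exactly one initial and one final end. *)
Definition coherent (D : seq dvertex) : bool :=
  uniq (flatten (map ins D)) &&
  perm_eq (flatten (map ins D)) (flatten (map outs D)).

Definition link_diagram (D : seq dvertex) : Prop :=
  coherent D /\ disk (map (fun v => ends (forget v)) D) [::].

Definition codes (D : seq dvertex) (U : seq vertex) : bool :=
  all2 same_vertex (map forget D) U.

Definition orientation_of (D : seq dvertex) (U : seq vertex) : bool :=
  coherent D && codes D U.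

(* Reidemeister moves, local pictures in a disk; the first argument lists the
   ends on the boundary of the disk, counterclockwise.
   R1: x is the edge of the kink.
   R2: the strand a-c is laid over the parallel strand b-d.
   R3: the strands are t1-t2 (top), m1-m2 (middle), b1-b2 (bottom); x, y, w are
   the edges of the triangle lying on the top, middle and bottom strand.  The
   two rules are the two cyclic orders in which the strands can end. *)
Inductive local_move : seq nat -> seq vertex -> seq vertex -> Prop :=
  | R1_under a b x :
      local_move [:: a; b] [:: Cross x x a b] [:: Point a b]
  | R1_over a b x :
      local_move [:: b; a] [:: Cross a x x b] [:: Point a b]
  | R2 a b c d x y :
      local_move [:: a; b; d; c]
        [:: Cross b x y a; Cross y x d c] [:: Point a c; Point b d]
  | R3_tmb t1 t2 m1 m2 b1 b2 x y w :
      local_move [:: t1; m1; b1; t2; m2; b2]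
        [:: Cross m1 x y t1; Cross b1 t2 w x; Cross w m2 b2 y]
        [:: Cross w x b2 t1; Cross y t2 m2 x; Cross b1 y w m1]
  | R3_tbm t1 t2 m1 m2 b1 b2 x y w :
      local_move [:: t1; b1; m1; t2; b2; m2]
        [:: Cross b1 x w t1; Cross m1 t2 y x; Cross w y b2 m2]
        [:: Cross y x m2 t1; Cross w t2 b2 x; Cross b1 m1 w y].

(* Elementary moves on oriented diagrams: change of the code of a diagram (order
   of the vertices, names of the edges), removal of a point, and the
   Reidemeister moves.  In [move_local] the ends s must be distinct: otherwise a
   component could lie entirely in D, and its orientation in D' would not be
   determined.  Since both sides are only considered when coherent, distinct
   ends are oriented by C.  (Ends can be made distinct by inserting points.) *)
Inductive move : seq dvertex -> seq dvertex -> Prop :=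
  | move_perm D D' : perm_eq D D' -> move D D'
  | move_rename f D :
      {in flatten (map ins D) &, injective f} -> move D (map (map_dvertex f) D)
  | move_point i o D :
      i != o ->
      move (DPoint i o :: D)
           (map (map_dvertex (fun e => if e == o then i else e)) D)
  | move_local s D D' C U U' :
      local_move s U U' -> uniq s -> codes D U -> codes D' U' -> move (D ++ C) (D' ++ C).

Local Open Scope ring_scope.

(* The Conway polynomial is the link invariant characterized by these three
   properties; its values on codes that are not link diagrams are irrelevant. *)
Record conway_polynomial (nabla : seq dvertex -> {poly int}) : Prop := {
  conway_invariant D D' :
    link_diagram D -> link_diagram D' -> move D D' -> nabla D = nabla D';
  conway_unknot e : nabla [:: DPoint e e] = 1;
  conway_skein l r l' r' C :
    link_diagram (DCross true l r l' r' :: C) ->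
    link_diagram (DCross false l r l' r' :: C) ->
    link_diagram [:: DPoint l l', DPoint r r' & C] ->
    nabla (DCross true l r l' r' :: C) - nabla (DCross false l r l' r' :: C)
      = 'X * nabla [:: DPoint l l', DPoint r r' & C]
}.

Local Close Scope ring_scope.

(* The legs of T and T' are numbered 0, ..., 5 in the counterclockwise order
   A_1, B_1, A_2, B_2, A_3, B_3 of the arcs of C they end on.  View a leg as
   vertical, with the trivalent vertex at the bottom and C at the top.  Between
   its i-th and (i+1)-st crossing (from the bottom) the leg has one edge on its
   left, [lft k i], and one on its right, [rgt k i].  So the left side of a leg
   is the counterclockwise one inside C and the clockwise one outside C. *)
Definition lft (k i : nat) : nat := 12 * i + 2 * k.
Definition rgt (k i : nat) : nat := 12 * i + 2 * k + 1.

(* |n| half twists along leg k, of the sign of n relative to the leg. *)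
Definition twist (k : nat) (n : int) : seq vertex :=
  [seq if (0 < n)%R then Cross (lft k i) (rgt k i) (rgt k i.+1) (lft k i.+1)
       else Cross (rgt k i) (rgt k i.+1) (lft k i.+1) (lft k i)
  | i <- iota 0 `|n|].

Definition K (p q r a b c : int) : seq vertex :=
  twist 0 p ++ twist 1 a ++ twist 2 q ++ twist 3 b ++ twist 4 r ++ twist 5 c ++
  (* middle points of the strands around T, passing B_1, B_2, B_3 *)
  [:: Point (lft 0 0) (rgt 2 0);
      Point (lft 2 0) (rgt 4 0);
      Point (lft 4 0) (rgt 0 0);
  (* middle points of the strands around T', passing A_2, A_3, A_1 *)
      Point (rgt 1 0) (lft 3 0);
      Point (rgt 3 0) (lft 5 0);
      Point (rgt 5 0) (lft 1 0);
  (* common end points of the arcs of C *)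
      Point (lft 0 `|p|) (lft 1 `|a|);
      Point (rgt 1 `|a|) (rgt 2 `|q|);
      Point (lft 2 `|q|) (lft 3 `|b|);
      Point (rgt 3 `|b|) (rgt 4 `|r|);
      Point (lft 4 `|r|) (lft 5 `|c|);
      Point (rgt 5 `|c|) (rgt 0 `|p|)].

(* The diagram does have an orientation when all labels are even. *)
Definition dtwist (k : nat) (n : int) : seq dvertex :=
  [seq if odd (k + i)
       then DCross (0 < n)%R (rgt k i) (rgt k i.+1) (lft k i) (lft k i.+1)
       else DCross (0 < n)%R (lft k i.+1) (lft k i) (rgt k i.+1) (rgt k i)
  | i <- iota 0 `|n|].

Definition dK (p q r a b c : int) : seq dvertex :=
  dtwist 0 p ++ dtwist 1 a ++ dtwist 2 q ++ dtwist 3 b ++ dtwist 4 r ++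
  dtwist 5 c ++
  [:: DPoint (rgt 2 0) (lft 0 0);
      DPoint (rgt 4 0) (lft 2 0);
      DPoint (rgt 0 0) (lft 4 0);
      DPoint (lft 3 0) (rgt 1 0);
      DPoint (lft 5 0) (rgt 3 0);
      DPoint (lft 1 0) (rgt 5 0);
      DPoint (lft 0 `|p|) (lft 1 `|a|);
      DPoint (rgt 1 `|a|) (rgt 2 `|q|);
      DPoint (lft 2 `|q|) (lft 3 `|b|);
      DPoint (rgt 3 `|b|) (rgt 4 `|r|);
      DPoint (lft 4 `|r|) (lft 5 `|c|);
      DPoint (rgt 5 `|c|) (rgt 0 `|p|)].

Definition leg_edges (k n : nat) : seq nat :=
  flatten [seq [:: lft k i; rgt k i] | i <- iota 0 n.+1].

Lemma codes_cat D1 D2 U1 U2 :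
  codes D1 U1 -> codes D2 U2 -> codes (D1 ++ D2) (U1 ++ U2).
Proof.
rewrite /codes map_cat.
by elim: (map forget D1) U1 => [|x s IH] [|y t] //= /andP[-> /IH].
Qed.

Lemma codes_dtwist k n : codes (dtwist k n) (twist k n).
Proof.
rewrite /codes /dtwist /twist; elim: (iota _ _) => //= i s ->; rewrite andbT.
by case: odd; case: (0 < n)%R; rewrite /same_vertex /= ?eqxx ?orbT.
Qed.

Lemma dtwist_edges k (n : int) : ~~ odd `|n| ->
  let: (x, y) := if odd k then (outs, ins) else (ins, outs) in
  perm_eq (flatten (map x (dtwist k n)) ++ [:: rgt k 0; lft k `|n|])
          (leg_edges k `|n|) /\
  perm_eq (flatten (map y (dtwist k n)) ++ [:: lft k 0; rgt k `|n|])
          (leg_edges k `|n|).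
Proof.
rewrite /dtwist => n_even; move: `|n| n_even (0 < n)%R => {}n n_even s.
rewrite -[n]odd_double_half (negbTE n_even) add0n; move: n./2 => {n_even}m.
have leg_edgesS j : leg_edges k j.+1 = leg_edges k j ++ [:: lft k j.+1; rgt k j.+1].
  by rewrite /leg_edges -addn1 iotaD map_cat flatten_cat.
elim: m => [|m IH]; first by rewrite double0; case: odd; split; apply/permP => P /=; lia.
rewrite doubleS -addn2 iotaD map_cat addn2 add0n !leg_edgesS.
move: (leg_edges k m.*2) IH => E; rewrite /= !addnS /= !oddD odd_double addbF.
case: (odd k);
  move=> /= -[/permP h1 /permP h2]; split; apply/permP => P;
  move: (h1 P) (h2 P); rewrite ?map_cat ?flatten_cat !count_cat /=;
  do ?[move: (nat_of_bool (P _)) => ?]; do ?[move: (count P _) => ?]; lia.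
Qed.

Lemma leg_edges_mod k n e : k < 6 -> e \in leg_edges k n -> (e %% 12)./2 = k.
Proof.
move=> k6 /flatten_mapP[i _]; rewrite !inE /lft /rgt => /orP[] /eqP ->; lia.
Qed.

Lemma leg_edges_uniq k n : uniq (leg_edges k n).
Proof.
suff h j : uniq (flatten [seq [:: lft k i; rgt k i] | i <- iota j n.+1]) by exact: h.
elim: n.+1 j => //= m IH j; rewrite IH andbT inE negb_or.
have N e : e < 12 * j.+1 + 2 * k ->
    e \notin flatten [seq [:: lft k i; rgt k i] | i <- iota j.+1 m].
  move=> le; apply/negP=> /flatten_mapP[i]; rewrite mem_iota !inE /lft /rgt.
  by move=> ? /orP[] /eqP; lia.
by rewrite !N ?/lft ?/rgt ?andbT; lia.
Qed.

Lemma all_edges_uniq (n : nat -> nat) m : m <= 6 ->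
  uniq (flatten [seq leg_edges k (n k) | k <- iota 0 m]).
Proof.
elim: m => // m IH m6; rewrite -addn1 iotaD map_cat flatten_cat [flatten (map _ (iota (0 + m) 1))]cats0 add0n.
rewrite cat_uniq IH 1?ltnW // leg_edges_uniq andbT.
apply/hasPn => e /leg_edges_mod em; apply/negP => /flatten_mapP[k].
by rewrite mem_iota => km /leg_edges_mod; rewrite em; lia.
Qed.

Lemma dK_orientation (p q r a b c : int) :
  ~~ odd `|p| -> ~~ odd `|q| -> ~~ odd `|r| ->
  ~~ odd `|a| -> ~~ odd `|b| -> ~~ odd `|c| ->
  orientation_of (dK p q r a b c) (K p q r a b c).
Proof.
move=> hp hq hr ha hb hc; apply/andP; split; last first.
  by do 6! apply: codes_cat (codes_dtwist _ _) _; rewrite /codes /= /same_vertex /= !eqxx ?orbT.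
have [/permP p1 /permP p2] := dtwist_edges 0 hp.
have [/permP a1 /permP a2] := dtwist_edges 1 ha.
have [/permP q1 /permP q2] := dtwist_edges 2 hq.
have [/permP b1 /permP b2] := dtwist_edges 3 hb.
have [/permP r1 /permP r2] := dtwist_edges 4 hr.
have [/permP c1 /permP c2] := dtwist_edges 5 hc.
have uE : uniq (leg_edges 0 `|p| ++ leg_edges 1 `|a| ++ leg_edges 2 `|q| ++
                leg_edges 3 `|b| ++ leg_edges 4 `|r| ++ leg_edges 5 `|c| ++ [::]).
  exact: (all_edges_uniq (nth 0 [:: `|p|%N; `|a|%N; `|q|%N; `|b|%N; `|r|%N; `|c|%N]) (leqnn 6)).
move: leg_edges uE p1 p2 a1 a2 q1 q2 b1 b2 r1 r2 c1 c2.
move=> F uE p1 p2 a1 a2 q1 q2 b1 b2 r1 r2 c1 c2.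
set E := _ ++ _ in uE *.
have hi : perm_eq (flatten (map ins (dK p q r a b c))) E.
  apply/permP => P; move: (p1 P) (a2 P) (q1 P) (b2 P) (r1 P) (c2 P).
  by rewrite /E /dK !map_cat !flatten_cat !count_cat /=;
  do ?[move: (nat_of_bool (P _)) => ?]; do ?[move: (count P _) => ?]; lia.
have ho : perm_eq (flatten (map outs (dK p q r a b c))) E.
  apply/permP => P; move: (p2 P) (a1 P) (q2 P) (b1 P) (r2 P) (c1 P).
  by rewrite /E /dK !map_cat !flatten_cat !count_cat /=;
  do ?[move: (nat_of_bool (P _)) => ?]; do ?[move: (count P _) => ?]; lia.
by rewrite /coherent (perm_uniq hi) uE (permPl hi) perm_sym.
Qed.

(* Main.v *)
(** The two strands of a leg with an even label are antiparallel.  Switching its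
    first crossing cancels two crossings (R2), and smoothing it turns the other
    crossings into kinks (R1).  So, with the other legs fixed, the polynomial of
    a leg with 2m positive crossings is that of the untwisted leg plus m X times
    that of the cut leg.  Expanding all six legs leaves 64 diagrams without
    crossings, whose value is 1 for a single circle and 0 otherwise.

    Planarity is handled by drawing the diagram once with each leg as a single
    vertex with four ends, in which any tangle drawn in a disk can be inserted.
    Coherence holds because every step only removes edges.  The diagram has only
    two orientations; that both give the same formula follows because reversing
    all strands turns Conway polynomials into Conway polynomials. *)
Require Import Defs.
From mathcomp Require Import all_boot all_order all_algebra.
From mathcomp Require Import zify ring.

Set Implicit Arguments.
Unset Strict Implicit.
Unset Printing Implicit Defensive.

Import Order.TTheory GRing.Theory Num.Theory.

(** * Tangles in disks *)

(** Substitution of a tangle for a vertex: the derivation that draws [X] is followed down to the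
    leaf that introduces [s], where the drawing of [V] is put instead; all later unions, rotations
    and joins apply unchanged. *)
Lemma disk_subst V s W t X :
  disk V s -> disk X t -> perm_eq X (s :: W) -> disk (V ++ W) t.
Proof.
move=> dV dX; elim: dX W => {X t}.
- by move=> W /perm_size.
- move=> u W XW; have W0 : W = [::] by move/perm_size: XW; case: (W).
  by move: XW; rewrite W0 cats0 => /(perm_mem) /(_ u); rewrite !inE eqxx => /esym /eqP->.
- move=> X1 X2 t1 t2 d1 IH1 d2 IH2 W XW.
  have : s \in X1 ++ X2 by rewrite (perm_mem XW) mem_head.
  rewrite mem_cat => /orP[] sX.
  + have := IH1 (rem s X1) (perm_to_rem sX) => d.
    apply: disk_perm (disk_union d d2); apply/permP=> P.
    have := permP XW P; have := permP (perm_to_rem sX) P; rewrite !count_cat /= ?count_cat; lia.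
  + have := IH2 (rem s X2) (perm_to_rem sX) => d.
    apply: disk_perm (disk_union d1 d); apply/permP=> P.
    have := permP XW P; have := permP (perm_to_rem sX) P; rewrite !count_cat /= ?count_cat; lia.
- move=> X1 X2 t X12 _ IH W XW; apply: IH; exact: perm_trans XW.
- by move=> n X t _ IH W /IH; apply: disk_rot.
- by move=> e X t _ IH W /IH; apply: disk_join.
Qed.

Lemma disk_map f V s : disk V s -> disk (map (map f) V) (map f s).
Proof.
elim=> {V s} /=.
- exact: disk_nil.
- by move=> s; apply: disk_vertex.
- by move=> V W s t _ dV _ dW; rewrite !map_cat; apply: disk_union.
- by move=> V W s VW _; apply: disk_perm; apply: perm_map.
- by move=> n V s _ d; rewrite map_rot; apply: disk_rot.
- by move=> e V s _; apply: disk_join.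
Qed.

Lemma disk_unrot n V s : disk V (rot n s) -> disk V s.
Proof. by move=> /(disk_rot (size (rot n s) - n)); rewrite -/(rotr _ _) rotK. Qed.

Lemma disk_rot_vertex n s W t : disk (s :: W) t -> disk (rot n s :: W) t.
Proof.
move=> d; apply: (disk_subst (V := [:: rot n s])) d (perm_refl _).
by apply: (@disk_unrot n); apply: disk_vertex.
Qed.

Lemma disk_cancel e V s t : disk V (s ++ [:: e, e & t]) -> disk V (s ++ t).
Proof.
move=> /(disk_rot (size s)); rewrite rot_size_cat /= => /disk_join.
by move=> d; apply: (@disk_unrot (size s)); rewrite rot_size_cat.
Qed.

(** Vertical stacking: each boundary lists the lower side from left to right, then the upper side
    from right to left, so in the union the ends [c] and [d] meet as nested adjacent pairs. *)
Lemma disk_stack V W a b c d e f :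
  disk V [:: a; b; d; c] -> disk W [:: c; d; f; e] ->
  disk (V ++ W) [:: a; b; f; e].
Proof.
move=> dV dW; have := disk_union dV dW => /=.
by move=> /(@disk_cancel c _ [:: a; b; d]) /(@disk_cancel d _ [:: a; b]).
Qed.

(** * Coherence under permutation, renaming and removal of edges *)

Definition pic (D : seq dvertex) := [seq ends (forget v) | v <- D].

Lemma pic_cat D D' : pic (D ++ D') = pic D ++ pic D'.
Proof. exact: map_cat. Qed.

Lemma ends_map_dvertex f v :
  ends (forget (map_dvertex f v)) = map f (ends (forget v)).
Proof. by case: v => [[]|]. Qed.

Lemma ins_map_dvertex f v : ins (map_dvertex f v) = map f (ins v).
Proof. by case: v. Qed.

Lemma outs_map_dvertex f v : outs (map_dvertex f v) = map f (outs v).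
Proof. by case: v. Qed.

Lemma pic_map f D : pic (map (map_dvertex f) D) = map (map f) (pic D).
Proof. by rewrite /pic -!map_comp; apply: eq_map => v /=; rewrite ends_map_dvertex. Qed.

Definition all_ins D := flatten (map ins D).
Definition all_outs D := flatten (map outs D).

Lemma all_ins_cat D D' : all_ins (D ++ D') = all_ins D ++ all_ins D'.
Proof. by rewrite /all_ins map_cat flatten_cat. Qed.

Lemma all_outs_cat D D' : all_outs (D ++ D') = all_outs D ++ all_outs D'.
Proof. by rewrite /all_outs map_cat flatten_cat. Qed.

Lemma all_ins_map f D : all_ins (map (map_dvertex f) D) = map f (all_ins D).
Proof.
rewrite /all_ins map_flatten -!map_comp; congr flatten.
by apply: eq_map => v /=; rewrite ins_map_dvertex.
Qed.

Lemma all_outs_map f D : all_outs (map (map_dvertex f) D) = map f (all_outs D).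
Proof.
rewrite /all_outs map_flatten -!map_comp; congr flatten.
by apply: eq_map => v /=; rewrite outs_map_dvertex.
Qed.

Lemma coherentE D : coherent D = uniq (all_ins D) && perm_eq (all_ins D) (all_outs D).
Proof. by []. Qed.

Lemma perm_all_ins D D' : perm_eq D D' -> perm_eq (all_ins D) (all_ins D').
Proof. by move=> DD'; apply: perm_flatten; apply: perm_map. Qed.

Lemma perm_all_outs D D' : perm_eq D D' -> perm_eq (all_outs D) (all_outs D').
Proof. by move=> DD'; apply: perm_flatten; apply: perm_map. Qed.

Lemma coherent_perm D D' : perm_eq D D' -> coherent D -> coherent D'.
Proof.
move=> DD'; rewrite !coherentE (perm_uniq (perm_all_ins DD')).
by rewrite (permPl (perm_all_ins DD')) (permPr (perm_all_outs DD')).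
Qed.

Lemma link_diagram_perm D D' : perm_eq D D' -> link_diagram D -> link_diagram D'.
Proof.
move=> DD' [cD dD]; split; first exact: coherent_perm cD.
by apply: disk_perm dD; apply: perm_map.
Qed.

(** The local changes below delete whole edges [e]: each loses its initial and its final end
    together, so coherence is inherited from the larger diagram. *)
Lemma coherent_sub e D D' C :
  perm_eq (all_ins D) (all_ins D' ++ e) -> perm_eq (all_outs D) (all_outs D' ++ e) ->
  coherent (D ++ C) -> coherent (D' ++ C).
Proof.
rewrite !coherentE !all_ins_cat !all_outs_cat => pi po /andP[u p].
have pi' : perm_eq (all_ins D ++ all_ins C) (e ++ (all_ins D' ++ all_ins C)).
  by rewrite catA perm_cat2r (permPl pi) perm_catC.
have po' : perm_eq (all_outs D ++ all_outs C) (e ++ (all_outs D' ++ all_outs C)).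
  by rewrite catA perm_cat2r (permPl po) perm_catC.
move: u p; rewrite (perm_uniq pi') cat_uniq (permPl pi') (permPr po') perm_cat2l.
by move=> /and3P[_ _ ->] ->.
Qed.

Lemma coherent_uniq_outs D : coherent D -> uniq (all_outs D).
Proof. by move=> /andP[u /perm_uniq <-]. Qed.

Lemma coherent_uniq_ins D : coherent D -> uniq (all_ins D).
Proof. by case/andP. Qed.

Lemma map_dvertex_id f D :
  {in all_ins D, f =1 id} -> {in all_outs D, f =1 id} -> map (map_dvertex f) D = D.
Proof.
elim: D => //= v D IH fi fo; rewrite IH; last 2 first.
- by move=> e eD; apply: fi; rewrite mem_cat eD orbT.
- by move=> e eD; apply: fo; rewrite mem_cat eD orbT.
congr (_ :: _); case: v fi fo => [s l r l' r'|i o] fi fo /=.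
- by rewrite !(fi l, fi r, fo l', fo r') // /all_ins /all_outs /= !inE eqxx ?orbT.
- by rewrite (fi i) ?(fo o) // /all_ins /all_outs /= inE eqxx.
Qed.

Definition subst_edge (i o e : nat) := if e == o then i else e.

Lemma subst_edge_id (i o : nat) (s : seq nat) : o \notin s -> {in s, subst_edge i o =1 id}.
Proof. by move=> os e es; rewrite /subst_edge; case: eqP => // eo; rewrite -eo es in os. Qed.

(** * Twisting two antiparallel strands *)

Lemma conway_perm nabla D D' : conway_polynomial nabla ->
  link_diagram D -> perm_eq D D' -> nabla D = nabla D'.
Proof.
move=> Hn lD DD'; apply: (conway_invariant Hn) lD (link_diagram_perm DD' lD) _.
exact: move_perm.
Qed.

(** By coherence the edge [o] starts only at the point and ends only at [v], so the renaming in
    [move_point] affects [v] alone and leaves [C] literally unchanged. *)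
Lemma point_elim nabla i o v C : conway_polynomial nabla ->
  i != o -> o \in ins v -> link_diagram [:: DPoint i o, v & C] ->
  let v' := map_dvertex (subst_edge i o) v in
  disk (pic (v' :: C)) [::] ->
  link_diagram (v' :: C) /\ nabla [:: DPoint i o, v & C] = nabla (v' :: C).
Proof.
move=> Hn io ov lD v' dv'; have [cD dD] := lD.
have := coherent_uniq_ins cD; have := coherent_uniq_outs cD.
rewrite /all_ins /all_outs /= mem_cat negb_or !cat_uniq.
move=> /andP[/andP[oov ooC] _] /and4P[_ uv vC _].
have oiC : o \notin all_ins C.
  by apply: contra vC => oC; apply/hasP; exists o.
have pv : perm_eq (all_ins [:: DPoint i o; v]) (all_ins [:: v'] ++ [:: o]).
  rewrite /all_ins /= !cats0 /v' ins_map_dvertex.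
  move: (perm_to_rem ov) (rem_uniq o uv) => pr ur.
  have /permP/(_ _) pm := perm_map (subst_edge i o) pr.
  have orem : o \notin rem o (ins v) by rewrite mem_rem_uniq // inE eqxx.
  apply/permP=> P; rewrite count_cat /= pm (permP pr P) /= (_ : subst_edge i o o = i) /subst_edge ?eqxx //.
  rewrite (_ : map _ _ = rem o (ins v)); first lia.
  by rewrite -[RHS]map_id; apply/eq_in_map; apply: (subst_edge_id _ orem).
have po : perm_eq (all_outs [:: DPoint i o; v]) (all_outs [:: v'] ++ [:: o]).
  rewrite /all_outs /= !cats0 /v' outs_map_dvertex.
  rewrite (_ : map _ _ = outs v); first by rewrite perm_sym perm_catC.
  by rewrite -[RHS]map_id; apply/eq_in_map; apply: (subst_edge_id _ oov).
have lv' : link_diagram (v' :: C).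
  by split=> //; exact: (coherent_sub (C := C) pv po cD).
split=> //; apply: (conway_invariant Hn) lD lv' _.
have := move_point (v :: C) io.
by rewrite /= -/(subst_edge i o) (map_dvertex_id (D := C)) //; apply: subst_edge_id.
Qed.

(** One strand climbs from [lft k 0] and the other descends, so both run from left to right through
    an even crossing and from right to left through an odd one. *)
Definition pos_cross (k i : nat) : dvertex :=
  if odd i then DCross true (rgt k i) (rgt k i.+1) (lft k i) (lft k i.+1)
  else DCross true (lft k i.+1) (lft k i) (rgt k i.+1) (rgt k i).

Definition twisted k j n := [seq pos_cross k i | i <- iota j n].

(** The turn closing the twist from below at level [i]; the climbing strand is on the left at even
    levels and on the right at odd ones, whence the alternating direction. *)
Definition cap (k i : nat) : dvertex :=
  if odd i then DPoint (lft k i) (rgt k i) else DPoint (rgt k i) (lft k i).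

Definition parallel k i j := [:: DPoint (lft k i) (lft k j); DPoint (rgt k j) (rgt k i)].
Definition cut k i j := [:: DPoint (lft k i) (rgt k i); DPoint (rgt k j) (lft k j)].

Lemma disk_pos_cross k i :
  disk (pic [:: pos_cross k i]) [:: lft k i; rgt k i; rgt k i.+1; lft k i.+1].
Proof.
rewrite /pic /= /pos_cross; case: odd => /=; last exact: disk_vertex.
by apply: (@disk_unrot 2); apply: disk_vertex.
Qed.

Lemma disk_twisted k j n :
  disk (pic (twisted k j n.+1)) [:: lft k j; rgt k j; rgt k (j + n.+1); lft k (j + n.+1)].
Proof.
elim: n j => [|n IH] j; first by rewrite addn1; apply: disk_pos_cross.
have := disk_stack (disk_pos_cross k j) (IH j.+1).
by rewrite addSnnS.
Qed.

Lemma disk_cap_twisted k j n :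
  disk ([:: rgt k j; lft k j] :: pic (twisted k j n)) [:: rgt k (j + n); lft k (j + n)].
Proof.
case: n => [|n]; first by rewrite addn0; apply: disk_vertex.
have := disk_union (disk_vertex [:: rgt k j; lft k j]) (disk_twisted k j n).
by move=> /(@disk_cancel _ _ [:: _]) /disk_join.
Qed.

Lemma disk_pic_cap k i C t :
  disk ([:: rgt k i; lft k i] :: C) t <-> disk (pic [:: cap k i] ++ C) t.
Proof.
rewrite /pic /cap /=; case: odd => //=.
by split=> /(disk_rot_vertex 1).
Qed.

(** The cap joins the two lower ends of the crossing, which becomes a kink; R1 removes it and leaves
    a cap one level higher. *)
Lemma cap_pos_cross nabla k i C : conway_polynomial nabla ->
  link_diagram [:: cap k i, pos_cross k i & C] ->
  disk ([:: rgt k i.+1; lft k i.+1] :: pic C) [::] ->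
  link_diagram (cap k i.+1 :: C) /\
  nabla [:: cap k i, pos_cross k i & C] = nabla (cap k i.+1 :: C).
Proof.
move=> Hn lD dC.
have dcap : disk (pic (cap k i.+1 :: C)) [::] by apply/disk_pic_cap.
have rl : rgt k i.+1 != lft k i.+1 by rewrite /lft /rgt; lia.
set o := if odd i then rgt k i else lft k i.
set o' := if odd i then lft k i else rgt k i.
have capE : cap k i = DPoint o' o by rewrite /cap /o /o'; case: odd.
have oo' : o' != o by rewrite /o /o' /lft /rgt; case: odd; lia.
have oin : o \in ins (pos_cross k i) by rewrite /o /pos_cross; case: odd; rewrite /= !inE eqxx ?orbT.
move: (lD); rewrite capE => lD'.
(* Once the point of the cap is removed, both lower ends of the crossing are the single edge [o'],
   the loop of the kink. *)
have kinkE : map_dvertex (subst_edge o' o) (pos_cross k i) =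
    if odd i then DCross true o' (rgt k i.+1) o' (lft k i.+1)
    else DCross true (lft k i.+1) o' (rgt k i.+1) o'.
  rewrite /o /o' /pos_cross /subst_edge; case: odd;
  rewrite /= /lft /rgt; repeat (case: eqP => ?; try lia); congr DCross; lia.
have [] := point_elim Hn oo' oin lD'.
  rewrite kinkE; apply: (disk_subst (V := [:: _])) dC (perm_refl _).
  case: odd => /=; last by apply: disk_join; apply: disk_vertex.
  by apply: (@disk_join o'); apply: (@disk_unrot 2); apply: disk_vertex.
rewrite kinkE; set v := (if odd i then _ else _) => lv ->.
have lc : link_diagram (cap k i.+1 :: C).
  split=> //; have [cv _] := lv.
  by apply: (coherent_sub (D := [:: v]) (D' := [:: _]) (e := [:: o'])) cv;
   apply/permP => P; rewrite /v /cap /=; case: odd => /=; lia.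
split=> //; apply: (conway_invariant Hn) lv lc _.
apply: (@move_local _ [:: v] [:: cap k i.+1] C _ _
  (R1_under (rgt k i.+1) (lft k i.+1) o')).
- by rewrite /= inE rl.
- by rewrite /codes /v /=; case: odd; rewrite /same_vertex /= ?eqxx ?orbT.
- by rewrite /codes /cap /=; case: odd; rewrite /same_vertex /= ?eqxx ?orbT.
Qed.

Lemma cap_twisted nabla k i n C : conway_polynomial nabla ->
  link_diagram (cap k i :: twisted k i n ++ C) ->
  disk ([:: rgt k (i + n); lft k (i + n)] :: pic C) [::] ->
  link_diagram (cap k (i + n) :: C) /\
  nabla (cap k i :: twisted k i n ++ C) = nabla (cap k (i + n) :: C).
Proof.
move=> Hn; elim: n i => [|n IH] i; first by rewrite addn0.
move=> lD dC; have [] := cap_pos_cross (C := twisted k i.+1 n ++ C) Hn lD.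
  have := disk_subst (disk_cap_twisted k i.+1 n) (W := pic C) (t := [::]).
  by rewrite addSnnS pic_cat => /(_ _ dC (perm_refl _)).
move=> l1 E; have [] := IH _ l1; rewrite addSnnS // => l2 <-; split=> //.
Qed.

Lemma disk_chain i o e W t : disk ([:: i; e] :: W) t -> disk [:: [:: i; o], [:: o; e] & W] t.
Proof.
move=> d; apply: (disk_subst (V := [:: [:: i; o]; [:: o; e]])) d (perm_refl _).
exact: (@disk_cancel o _ [:: i] [:: e] (disk_union (disk_vertex [:: i; o]) (disk_vertex [:: o; e]))).
Qed.

Lemma chain_elim nabla i o e C : conway_polynomial nabla ->
  coherent [:: DPoint i o, DPoint o e & C] -> disk ([:: i; e] :: pic C) [::] ->
  link_diagram (DPoint i e :: C) /\
  nabla [:: DPoint i o, DPoint o e & C] = nabla (DPoint i e :: C).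
Proof.
move=> Hn cD dC; have := coherent_uniq_ins cD; have := coherent_uniq_outs cD.
rewrite /all_ins /all_outs /= !inE !negb_or => /andP[/andP[oe _] _] /andP[/andP[io _] _].
have [] := point_elim (v := DPoint o e) Hn io (mem_head _ _) (conj cD (disk_chain o dC));
  by rewrite /= /subst_edge eqxx [e == o]eq_sym (negbTE oe).
Qed.

Lemma disk_parallel k i j :
  disk (pic (parallel k i j)) [:: lft k i; rgt k i; rgt k j; lft k j].
Proof.
apply: (@disk_unrot 3).
exact: (disk_union (disk_rot 1 (disk_vertex [:: lft k i; lft k j]))
                   (disk_rot 1 (disk_vertex [:: rgt k j; rgt k i]))).
Qed.

Lemma disk_cut k i j : disk (pic (cut k i j)) [:: lft k i; rgt k i; rgt k j; lft k j].
Proof. exact: (disk_union (disk_vertex [:: lft k i; rgt k i]) (disk_vertex [:: rgt k j; lft k j])). Qed.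

Local Open Scope ring_scope.

(** The skein relation at the lower of two crossings: switched, it cancels against the upper one by
    R2; smoothed, it leaves a cap below the upper crossing and a turn at level [j]. *)
Lemma skein_pos_cross nabla k j R : conway_polynomial nabla -> ~~ odd j ->
  link_diagram [:: pos_cross k j, pos_cross k j.+1 & R] ->
  disk ([:: lft k j; rgt k j; rgt k j.+2; lft k j.+2] :: pic R) [::] ->
  let D0 := [:: cap k j.+1, DPoint (lft k j) (rgt k j), pos_cross k j.+1 & R] in
  [/\ link_diagram (parallel k j j.+2 ++ R), link_diagram D0 &
   nabla [:: pos_cross k j, pos_cross k j.+1 & R] =
   nabla (parallel k j j.+2 ++ R) + 'X * nabla D0].
Proof.
move=> Hn jev lD dR D0; have [cD _] := lD.
have xj : pos_cross k j = DCross true (lft k j.+1) (lft k j) (rgt k j.+1) (rgt k j).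
  by rewrite /pos_cross (negbTE jev).
have xj1 : pos_cross k j.+1 = DCross true (rgt k j.+1) (rgt k j.+2) (lft k j.+1) (lft k j.+2).
  by rewrite /pos_cross /= jev.
have capE : cap k j.+1 = DPoint (lft k j.+1) (rgt k j.+1) by rewrite /cap /= jev.
set v := DCross false (lft k j.+1) (lft k j) (rgt k j.+1) (rgt k j).
have lv : link_diagram [:: v, pos_cross k j.+1 & R].
  split; first by rewrite xj in cD.
  apply: (disk_subst (V := pic [:: v; pos_cross k j.+1])) dR (perm_refl _).
  apply: (@disk_stack (pic [:: v]) _ _ _ (lft k j.+1) (rgt k j.+1)); last exact: disk_pos_cross.
  by apply: (@disk_unrot 3); apply: disk_vertex.
have l0 : link_diagram D0.
  split.
    by apply: (coherent_sub (D := [:: pos_cross k j]) (D' := [:: _; _]) (e := [::])) cD;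
     rewrite xj capE.
  apply: (disk_subst (V := pic [:: cap k j.+1; DPoint (lft k j) (rgt k j); pos_cross k j.+1])) dR (perm_refl _).
  apply: (@disk_stack (pic [:: cap k j.+1; DPoint (lft k j) (rgt k j)]) _ _ _ (lft k j.+1) (rgt k j.+1)); last exact: disk_pos_cross.
  rewrite capE; apply: (@disk_unrot 2).
  exact: (disk_union (disk_rot 1 (disk_vertex [:: lft k j.+1; rgt k j.+1]))
                     (disk_vertex [:: lft k j; rgt k j])).
have lp : link_diagram (parallel k j j.+2 ++ R).
  split.
    apply: (coherent_sub (D := [:: pos_cross k j; pos_cross k j.+1]) (e := [:: lft k j.+1; rgt k j.+1])) cD;
    by rewrite xj xj1; apply/permP=> P /=; lia.
  by rewrite -/(pic _) pic_cat; apply: (disk_subst (disk_parallel _ _ _) dR (perm_refl _)).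
split=> //.
have := conway_skein Hn (C := pos_cross k j.+1 :: R) (l := lft k j.+1) (r := lft k j) (l' := rgt k j.+1) (r' := rgt k j).
rewrite -xj -capE => /(_ lD lv l0) /eqP; rewrite subr_eq => /eqP ->; rewrite addrC; congr (_ + _).
apply: (conway_invariant Hn) lv lp _.
apply: (@move_local _ [:: v; pos_cross k j.+1] (parallel k j j.+2) R _ _
  (R2 (lft k j) (rgt k j) (lft k j.+2) (rgt k j.+2) (rgt k j.+1) (lft k j.+1))).
- by rewrite /= !inE /lft /rgt; lia.
- by rewrite /codes xj1 /= /same_vertex /= !eqxx ?orbT.
- by rewrite /codes /= /same_vertex /= !eqxx ?orbT.
Qed.

(** Induction on the pairs of crossings, from the bottom. Smoothing in any pair gives a cap that
    unwinds everything above it, so each of the [m.+1] pairs contributes ['X] times the same cut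
    leg. *)
Lemma twisted_expansion nabla k j m C : conway_polynomial nabla -> ~~ odd j ->
  let n := m.+1.*2 in
  link_diagram (twisted k j n ++ C) ->
  disk ([:: lft k j; rgt k j; rgt k (j + n); lft k (j + n)] :: pic C) [::] ->
  [/\ link_diagram (parallel k j (j + n) ++ C), link_diagram (cut k j (j + n) ++ C) &
   nabla (twisted k j n ++ C) =
   nabla (parallel k j (j + n) ++ C) + m.+1%:R * 'X * nabla (cut k j (j + n) ++ C)].
Proof.
move=> Hn; elim: m j C => [|m IH] j C jev n lD dC.
  have [] := skein_pos_cross Hn jev lD; first by rewrite /n addn2 in dC.
  move=> lp l0 E.
  have jev1 : cap k j.+2 = DPoint (rgt k j.+2) (lft k j.+2) by rewrite /cap /= negbK (negbTE jev).
  have l0' : link_diagram (cap k j.+1 :: twisted k j.+1 1 ++ DPoint (lft k j) (rgt k j) :: C).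
    by apply: link_diagram_perm l0; apply/permP=> P /=; lia.
  have := cap_twisted Hn l0'; rewrite addn1 jev1 => -[].
    apply: (disk_perm (V := pic (cut k j j.+2 ++ C))).
      by rewrite /pic /=; apply/permP=> P /=; lia.
    rewrite pic_cat; rewrite /n addn2 in dC; exact: (disk_subst (disk_cut _ _ _) dC (perm_refl _)).
  move=> l1 E1; rewrite E /n addn2.
  have l1' : link_diagram (cut k j j.+2 ++ C).
    by apply: link_diagram_perm l1; apply/permP=> P /=; lia.
  split=> //; rewrite mul1r; congr (_ + _ * _).
  rewrite (conway_perm Hn l1' (D' := [:: DPoint (rgt k j.+2) (lft k j.+2), DPoint (lft k j) (rgt k j) & C])).
    by rewrite -E1; apply: conway_perm => //; apply/permP=> P /=; lia.
  by apply/permP=> P /=; lia.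
have nE : n = (m.+1.*2).+2 by [].
set n' := m.+1.*2 in nE; rewrite nE in lD dC *.
have jE : (j + n'.+2 = j.+2 + n')%N by lia.
have [] := skein_pos_cross (R := twisted k j.+2 n' ++ C) Hn jev lD.
  rewrite pic_cat; move: (disk_twisted k j.+2 n'.-1); rewrite prednK //.
  set V := pic (twisted _ _ _) => dV.
  have := @disk_subst ([:: lft k j; rgt k j; rgt k j.+2; lft k j.+2] :: V) _ (pic C) [::] _ _ dC (perm_refl _).
  apply; rewrite jE.
  apply: (@disk_stack [:: _] _ _ _ (lft k j.+2) (rgt k j.+2)) => //; exact: disk_vertex.
set D0 := [:: cap _ _, _, _ & _] => lp l0 E.
have jev2 : ~~ odd j.+2 by rewrite /= negbK.
have [] := IH j.+2 (parallel k j j.+2 ++ C) jev2.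
- by apply: link_diagram_perm lp; rewrite perm_catCA.
- rewrite -/n' pic_cat -jE.
  apply: (@disk_perm (pic (parallel k j j.+2) ++ [:: [:: lft k j.+2; rgt k j.+2; rgt k (j + n'.+2); lft k (j + n'.+2)]] ++ pic C)).
    by apply/permP => P /=; rewrite ?count_cat /=; lia.
  rewrite catA; apply: (disk_subst _ dC (perm_refl _)).
  apply: (@disk_stack _ _ _ _ (lft k j.+2) (rgt k j.+2)); [exact: disk_parallel | exact: disk_vertex].
rewrite -/n' -jE => lpp lcp E'.
set N := (j + n'.+2)%N in lpp lcp E' dC *.
have jN : (j.+2 < N)%N by rewrite /N /n'; lia.
have dpar : disk (pic (parallel k j N ++ C)) [::].
  by rewrite pic_cat; apply: (disk_subst (disk_parallel _ _ _) dC (perm_refl _)).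
have dcut : disk (pic (cut k j N ++ C)) [::].
  by rewrite pic_cat; apply: (disk_subst (disk_cut _ _ _) dC (perm_refl _)).
have capN : cap k N = DPoint (rgt k N) (lft k N).
  by rewrite /cap (_ : odd N = false) // /N /n' /=; lia.
(* The cap at level [j.+1] travels up through the remaining [n'.+1] crossings and becomes the upper
   turn of the cut leg. *)
have E0 : nabla D0 = nabla (cut k j N ++ C).
  have p0 : perm_eq D0 (cap k j.+1 :: twisted k j.+1 n'.+1 ++ DPoint (lft k j) (rgt k j) :: C).
    by apply/permP=> P; rewrite /= !count_cat /=; lia.
  have := cap_twisted Hn (link_diagram_perm p0 l0); rewrite -addSnnS (_ : (j.+2 + n')%N = N) // capN => -[].
    apply: disk_perm dcut; apply/permP=> P /=; lia.
  rewrite (conway_perm Hn l0 p0) => l1 ->; apply: conway_perm => //.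
  by apply/permP=> P /=; lia.
(* The induction hypothesis starts at level [j.+2]; the straight pieces below it are merged into the
   leg, first on the left strand, then on the right. *)
have [lpar Epar] : link_diagram (parallel k j N ++ C) /\
    nabla (parallel k j.+2 N ++ parallel k j j.+2 ++ C) = nabla (parallel k j N ++ C).
  set C1 := [:: DPoint (rgt k N) (rgt k j.+2), DPoint (rgt k j.+2) (rgt k j) & C].
  have p1 : perm_eq (parallel k j.+2 N ++ parallel k j j.+2 ++ C)
      [:: DPoint (lft k j) (lft k j.+2), DPoint (lft k j.+2) (lft k N) & C1].
    by apply/permP=> P /=; lia.
  have [] := chain_elim Hn (link_diagram_perm p1 lpp).1.
    rewrite /C1 /=; apply: (@disk_perm [:: [:: rgt k N; rgt k j.+2], [:: rgt k j.+2; rgt k j], [:: lft k j; lft k N] & pic C]).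
      by apply/permP=> P /=; lia.
    apply: disk_chain; apply: disk_perm dpar; apply/permP=> P /=; lia.
  rewrite -(conway_perm Hn lpp p1) => l1 ->.
  have p2 : perm_eq (DPoint (lft k j) (lft k N) :: C1)
      [:: DPoint (rgt k N) (rgt k j.+2), DPoint (rgt k j.+2) (rgt k j), DPoint (lft k j) (lft k N) & C].
    by apply/permP=> P /=; lia.
  have [] := chain_elim Hn (link_diagram_perm p2 l1).1.
    by apply: disk_perm dpar; apply/permP=> P /=; lia.
  rewrite -(conway_perm Hn l1 p2) => l2 ->.
  have p3 : perm_eq [:: DPoint (rgt k N) (rgt k j), DPoint (lft k j) (lft k N) & C] (parallel k j N ++ C).
    by apply/permP=> P /=; lia.
  by split; [apply: link_diagram_perm l2 | apply: conway_perm].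
have [lcut Ecut] : link_diagram (cut k j N ++ C) /\
    nabla (cut k j.+2 N ++ parallel k j j.+2 ++ C) = nabla (cut k j N ++ C).
  set C1 := [:: DPoint (rgt k j.+2) (rgt k j), DPoint (rgt k N) (lft k N) & C].
  have dC1 : disk ([:: lft k j; rgt k j] :: pic (DPoint (rgt k N) (lft k N) :: C)) [::] by [].
  have p1 : perm_eq (cut k j.+2 N ++ parallel k j j.+2 ++ C)
      [:: DPoint (lft k j) (lft k j.+2), DPoint (lft k j.+2) (rgt k j.+2) & C1].
    by apply/permP=> P /=; lia.
  have [] := chain_elim Hn (link_diagram_perm p1 lcp).1; first exact: disk_chain dC1.
  rewrite -(conway_perm Hn lcp p1) => l1 ->.
  by have [l2 ->] := chain_elim Hn l1.1 dC1.
split=> //.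
have Ecat : nabla (parallel k j j.+2 ++ twisted k j.+2 n' ++ C) =
    nabla (twisted k j.+2 n' ++ parallel k j j.+2 ++ C).
  by apply: conway_perm => //; rewrite perm_catCA.
by rewrite E Ecat E' Epar Ecut E0; ring.
Qed.

(** * Reversal of all strands *)

(** A half turn makes the reversed strands of a crossing point upwards again: opposite corners are
    exchanged and the sign is kept. *)
Definition reverse_vertex (v : dvertex) : dvertex :=
  match v with
  | DCross s l r l' r' => DCross s r' l' r l
  | DPoint i o => DPoint o i
  end.

Definition reverse (D : seq dvertex) := map reverse_vertex D.

Lemma reverse_vertexK : involutive reverse_vertex.
Proof. by case. Qed.

Lemma reverseK : involutive reverse.
Proof. exact: mapK reverse_vertexK. Qed.

Lemma reverse_cat D D' : reverse (D ++ D') = reverse D ++ reverse D'.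
Proof. exact: map_cat. Qed.

Lemma reverse_map f D : reverse (map (map_dvertex f) D) = map (map_dvertex f) (reverse D).
Proof. by rewrite /reverse -!map_comp; apply: eq_map => -[]. Qed.

Lemma all_ins_reverse D : perm_eq (all_ins (reverse D)) (all_outs D).
Proof.
rewrite /all_ins /all_outs; elim: D => //= v D IH; apply: perm_cat => //.
by case: v => // s l r l' r'; rewrite /= perm_sym (perm_catC [:: l'] [:: r']).
Qed.

Lemma all_outs_reverse D : perm_eq (all_outs (reverse D)) (all_ins D).
Proof. by rewrite -{2}[D]reverseK perm_sym all_ins_reverse. Qed.

Lemma coherent_reverse D : coherent (reverse D) = coherent D.
Proof.
rewrite !coherentE (perm_uniq (all_ins_reverse D)) (permPl (all_ins_reverse D)).
rewrite (permPr (all_outs_reverse D)) perm_sym.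
by apply/andP/andP=> -[u p]; split=> //; move: u; rewrite (perm_uniq p).
Qed.

Lemma disk_reverse D W t : disk (pic D ++ W) t -> disk (pic (reverse D) ++ W) t.
Proof.
elim: D W => //= v D IH W d.
have d1 : disk (ends (forget (reverse_vertex v)) :: pic D ++ W) t.
  by case: v d => [[] l r l' r'|i o] /= /(disk_rot_vertex 2); rewrite /rot /=;
     do ?[exact]; move/(disk_rot_vertex 1).
have p : perm_eq (ends (forget (reverse_vertex v)) :: pic D ++ W)
    (pic D ++ ends (forget (reverse_vertex v)) :: W).
  by apply/permP=> P; rewrite /= !count_cat /=; lia.
have := IH _ (disk_perm p d1); apply: disk_perm.
by apply/permP=> P; rewrite /= !count_cat /=; lia.
Qed.

Lemma link_diagram_reverse D : link_diagram D -> link_diagram (reverse D).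
Proof.
case=> cD dD; split; first by rewrite coherent_reverse.
by have := @disk_reverse D [::] [::]; rewrite !cats0; apply.
Qed.

Lemma same_vertex_reverse v w :
  same_vertex (forget (reverse_vertex v)) w = same_vertex (forget v) w.
Proof.
case: v w => [[] l r l' r'|i o] [a b c d|a b] //=;
  by rewrite /same_vertex /rot /= orbC.
Qed.

Lemma codes_reverse D U : codes (reverse D) U = codes D U.
Proof.
rewrite /codes /reverse; elim: D U => [|v D IH] [|u U] //=.
by rewrite same_vertex_reverse IH.
Qed.

Lemma link_diagram_map f D :
  {in all_ins D &, injective f} -> link_diagram D -> link_diagram (map (map_dvertex f) D).
Proof.
move=> f_inj [cD dD]; split; last by have := disk_map f dD; rewrite -/(pic D) -pic_map.
move: cD; rewrite !coherentE all_ins_map all_outs_map map_inj_in_uniq // => /andP[-> /=].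
exact: perm_map.
Qed.

(** The local moves and the skein triple are stable under reversal, since the codes in [local_move]
    carry no orientation; only the removal of a point is asymmetric. *)
Lemma conway_reverse nabla : conway_polynomial nabla -> conway_polynomial (nabla \o reverse).
Proof.
move=> Hn; split=> [D D' lD lD' mv|e|l r l' r' C lp ln l0] /=; last 2 first.
- exact: conway_unknot.
- have := link_diagram_reverse l0; have := link_diagram_reverse ln; have := link_diagram_reverse lp.
  move=> /= lp' ln' l0'.
  have p : perm_eq [:: DPoint l' l, DPoint r' r & reverse C] [:: DPoint r' r, DPoint l' l & reverse C].
    by apply/permP=> P /=; lia.
  rewrite (conway_skein Hn) //; last exact: link_diagram_perm p l0'.
  by congr (_ * _)%R; apply/esym/conway_perm.
have rD := link_diagram_reverse lD; have rD' := link_diagram_reverse lD'.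
case: mv lD lD' rD rD' => {D D'}.
- by move=> D D' p _ _ rD _; apply: conway_perm; rewrite ?perm_map.
- move=> f D f_inj _ _ rD rD'; rewrite reverse_map in rD' *.
  apply: (conway_invariant Hn) => //; apply: move_rename.
  have /coherent_uniq_ins _ := rD.1.
  have mem e : e \in all_ins (reverse D) -> e \in all_ins D.
    rewrite (perm_mem (all_ins_reverse D)); have := (link_diagram_reverse rD).1.
    by rewrite reverseK coherentE => /andP[_ /perm_mem ->].
  by move=> x y /mem xD /mem yD; apply: f_inj.
(* Removing the reversed point gives the merged edge the name [o] instead of [i]. A renaming repairs
   this, and it is injective because [o] no longer occurs in [D']. *)
- move=> i o D io [cD _] lD' rD rD'; rewrite reverse_map in rD' *.
  rewrite -/(subst_edge i o) in lD' rD' *.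
  set D' := map _ _ in rD' *.
  have noD' : o \notin all_ins D'.
    rewrite all_ins_map; apply/mapP=> -[e _]; rewrite /subst_edge.
    by case: eqP => [_ /eqP|eo oe]; [rewrite eq_sym (negbTE io) | case: eo].
  have g_inj : {in all_ins D' &, injective (subst_edge o i)}.
    move=> x y xD yD; rewrite /subst_edge.
    have xo : x != o by apply: contraNneq noD' => <-.
    have yo : y != o by apply: contraNneq noD' => <-.
    case: eqP => [->|_]; case: eqP => [->|_] // E; last by rewrite E eqxx in xo.
    by rewrite -E eqxx in yo.
  have ED' : map (map_dvertex (subst_edge o i)) D' =
             map (map_dvertex (subst_edge o i)) (reverse D).
    rewrite /D' -map_comp; apply: eq_map => v /=.
    have h e : subst_edge o i (subst_edge i o e) = subst_edge o i e.
      by rewrite /subst_edge; case: (e =P o) => [->|//]; rewrite eqxx eq_sym (negbTE io).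
    by case: v => [s l r l' r'|a b] /=; rewrite !h.
  have lD2 := link_diagram_map g_inj rD'.
  rewrite (conway_invariant Hn rD' lD2 (move_rename g_inj)) ED'.
  rewrite ED' in lD2; apply: (conway_invariant Hn) => //.
  by have := @move_point o i (reverse D); rewrite eq_sym; apply.
- move=> s D D' C U U' loc us cD cD' _ _; rewrite !reverse_cat => rD rD'.
  by apply: (conway_invariant Hn) => //; apply: move_local loc us _ _; rewrite codes_reverse.
Qed.

Definition orient (b : bool) (D : seq dvertex) := if b then reverse D else D.

(** For the reversed leg, the expansion is applied to the Conway polynomial [nabla \o reverse] and
    the reversed rest of the diagram. *)
Lemma twisted_expansion_oriented nabla s k m C : conway_polynomial nabla ->
  let n := m.+1.*2 in
  link_diagram (orient s (twisted k 0 n) ++ C) ->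
  disk ([:: lft k 0; rgt k 0; rgt k n; lft k n] :: pic C) [::] ->
  [/\ link_diagram (orient s (parallel k 0 n) ++ C),
      link_diagram (orient s (cut k 0 n) ++ C) &
   nabla (orient s (twisted k 0 n) ++ C) =
   nabla (orient s (parallel k 0 n) ++ C) + m.+1%:R * 'X * nabla (orient s (cut k 0 n) ++ C)].
Proof.
case: s => Hn n lD dC; last exact: (twisted_expansion Hn).
have Hr := conway_reverse Hn.
have [] := @twisted_expansion (nabla \o reverse) k 0 m (reverse C) Hr isT.
- by have := link_diagram_reverse lD; rewrite reverse_cat /= reverseK.
- rewrite add0n -/n; move: dC; set x := [:: _; _; _; _] => dC.
  have p D : perm_eq (pic D ++ [:: x]) (x :: pic D) by rewrite perm_catC.
  by apply: disk_perm (p _) (disk_reverse _); apply: disk_perm dC; rewrite perm_sym.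
rewrite add0n -/n => lp lc /=; rewrite !reverse_cat !reverseK => E; split=> //.
- by have := link_diagram_reverse lp; rewrite reverse_cat reverseK.
- by have := link_diagram_reverse lc; rewrite reverse_cat reverseK.
Qed.

(** Reversal exchanges the even and the odd form of [pos_cross], which is the shift of parity by [k]
    in [dtwist]. *)
Lemma dtwist_twisted k (n : int) : 0 < n -> dtwist k n = orient (odd k) (twisted k 0 `|n|).
Proof.
rewrite /dtwist /twisted => ->; case ek: (odd k); rewrite /orient.
  rewrite /reverse -map_comp; apply: eq_map => i /=.
  by rewrite oddD ek /pos_cross; case: odd.
by apply: eq_map => i /=; rewrite oddD ek.
Qed.

(** * Diagrams without crossings *)

Definition points (s : seq (nat * nat)) := [seq DPoint x.1 x.2 | x <- s].

Lemma all_ins_points s : all_ins (points s) = unzip1 s.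
Proof. by rewrite /all_ins; elim: s => //= x s ->. Qed.

Lemma all_outs_points s : all_outs (points s) = unzip2 s.
Proof. by rewrite /all_outs; elim: s => //= x s ->. Qed.

Lemma coherent_points_chain i o e s :
  coherent (points [:: (i, o), (o, e) & s]) -> coherent (points ((i, e) :: s)).
Proof.
by apply: (coherent_sub (D := [:: DPoint i o; DPoint o e]) (D' := [:: DPoint i e])
  (e := [:: o])); apply/permP=> P /=; lia.
Qed.

Lemma coherent_points_loop i s : coherent (points ((i, i) :: s)) -> coherent (points s).
Proof. exact: (coherent_sub (D := [:: DPoint i i]) (D' := [::]) (e := [:: i])). Qed.

(** If the first arc is not a loop, coherence supplies an arc starting where it ends, and merging
    the two lowers the number of arcs; a loop is drawn in a disk of its own. *)
Lemma disk_points s : coherent (points s) -> disk (pic (points s)) [::].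
Proof.
move: {2}(size s) (erefl (size s)) => n; elim: n s => [|n IH] [|[i o] s] //= sn cs; first exact: disk_nil.
case: sn => sn.
have [io|io] := eqVneq i o.
  rewrite -io in cs *; have ds := IH _ sn (coherent_points_loop cs).
  exact: (disk_union (disk_join (disk_vertex [:: i; i])) ds).
have oin : o \in all_ins (points ((i, o) :: s)).
  by move: cs; rewrite coherentE => /andP[_ /perm_mem->]; rewrite (all_outs_points ((i, o) :: s)) mem_head.
move: oin; rewrite all_ins_points inE eq_sym (negbTE io) /= => /mapP[[o1 e] oe /= Eo].
rewrite -Eo in oe; clear o1 Eo.
have p := perm_to_rem oe.
have p' : perm_eq ((i, o) :: s) [:: (i, o), (o, e) & rem (o, e) s] by rewrite perm_cons.
have cs' := coherent_perm (perm_map _ p') cs.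
have := IH ((i, e) :: rem (o, e) s); rewrite /= size_rem // sn.
have n0 : (0 < n)%N by rewrite -sn; case: (s) oe.
rewrite prednK // => /(_ erefl (coherent_points_chain cs')) /(@disk_chain i o).
apply: disk_perm; rewrite perm_sym.
by have := perm_map (fun v => ends (forget v)) (perm_map (fun x => DPoint x.1 x.2) p').
Qed.

Lemma link_diagram_points s : coherent (points s) -> link_diagram (points s).
Proof. by move=> cs; split=> //; apply: disk_points. Qed.

(* Both resolutions of a kink joining a loop to another component are the same
   diagram up to the first Reidemeister move. *)
Lemma conway_points_loop nabla e i o s : conway_polynomial nabla -> i != o ->
  coherent (points [:: (e, e), (i, o) & s]) -> nabla (points [:: (e, e), (i, o) & s]) = 0.
Proof.
move=> Hn io cs; have l0 := link_diagram_points cs.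
have l1 := link_diagram_points (coherent_points_loop cs).
have dC := l1.2.
have lkink b : link_diagram (DCross b e i e o :: points s).
  split.
    by apply: (coherent_sub (D := [:: DPoint e e; DPoint i o]) (D' := [:: _]) (e := [::])) cs; case: b.
  apply: (disk_subst (V := [:: _])) dC (perm_refl _).
  case: b => /=; first exact: (@disk_cancel e _ [:: i; o] [::] (disk_vertex _)).
  by apply: (@disk_join e); exact: (disk_rot 3 (disk_vertex [:: e; i; o; e])).
have Ekink b : nabla (DCross b e i e o :: points s) = nabla (points ((i, o) :: s)).
  apply: (conway_invariant Hn) => //.
  case: b.
  - apply: (@move_local _ [:: DCross true e i e o] [:: DPoint i o] (points s) _ _ (R1_under i o e)).
    + by rewrite /= inE io.
    + by rewrite /codes /= /same_vertex /= eqxx orbT.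
    + by rewrite /codes /= /same_vertex /= eqxx.
  - apply: (@move_local _ [:: DCross false e i e o] [:: DPoint i o] (points s) _ _ (R1_over o i e)).
    + by rewrite /= inE io.
    + by rewrite /codes /= /same_vertex /= eqxx orbT.
    + by rewrite /codes /= /same_vertex /= eqxx orbT.
have /eqP := conway_skein Hn (lkink true) (lkink false) l0.
by rewrite !Ekink subrr eq_sym mulf_eq0 polyX_eq0 => /eqP.
Qed.

Fixpoint extract (o : nat) (s : seq (nat * nat)) : option (nat * seq (nat * nat)) :=
  if s is (a, b) :: s' then
    if a == o then Some (b, s')
    else if extract o s' is Some (e, t) then Some (e, (a, b) :: t) else None
  else None.

Lemma extract_perm o s e t : extract o s = Some (e, t) -> perm_eq s ((o, e) :: t).
Proof.
elim: s t => //= -[a b] s IH t; case: eqP => [-> [-> ->]|_] //.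
case: (extract o s) IH => // -[e1 t1] IH [E <-]; rewrite E in IH.
have /permP p := IH _ erefl; apply/permP=> P; rewrite /= p /=; lia.
Qed.

(* Follows the first component until it closes up; [None] is a junk value. *)
Fixpoint is_circle (fuel : nat) (s : seq (nat * nat)) : option bool :=
  match fuel, s with
  | n.+1, (i, o) :: s' =>
    if i == o then
      match s' with
      | [::] => Some true
      | (i', o') :: _ => if i' == o' then None else Some false
      end
    else if extract o s' is Some (e, t) then is_circle n ((i, e) :: t) else None
  | _, _ => None
  end.

(** Merging consecutive arcs keeps the polynomial. When the first component has become a loop, it is
    either the whole diagram, an unknot, or accompanied by a further arc that is not a loop, which
    forces the value 0. *)
Lemma conway_points nabla n s b : conway_polynomial nabla ->
  coherent (points s) -> is_circle n s = Some b -> nabla (points s) = b%:R.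
Proof.
move=> Hn; elim: n s => [|n IH] [|[i o] s] //= cs.
case: eqP => [io|/eqP io].
  rewrite -io in cs *; case: s cs => [|[i' o'] s] cs.
    by case=> <-; apply: conway_unknot.
  by case: eqP => // /eqP io' [<-]; apply: conway_points_loop.
case E: (extract o s) => [[e t]|] // eb.
have p : perm_eq ((i, o) :: s) [:: (i, o), (o, e) & t] by rewrite perm_cons extract_perm.
have cp := coherent_perm (perm_map _ p) cs.
have ce := coherent_points_chain cp.
rewrite -(IH _ ce eb).
have [_ <-] := chain_elim Hn cp (disk_points ce).
by apply: conway_perm => //; [exact: (@link_diagram_points ((i, o) :: s) cs) | exact: (perm_map _ p)].
Qed.

(** * Expansion along the six legs *)

(** A stack pass over the boundary of a disk: an end equal to the one on top of the stack is joined
    to it, otherwise it is stored. *)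
Definition push (st : seq nat) (e : nat) :=
  if st is x :: st' then if x == e then st' else e :: st else [:: e].

Lemma disk_push V st w : disk V (rev st ++ w) -> disk V (rev (foldl push st w)).
Proof.
elim: w st => [|e w IH] [|x st] /=; rewrite ?cats0 //.
- exact: (IH [:: e]).
- case: eqP => [->|_] d; apply: IH.
    by apply: (@disk_cancel e); move: d; rewrite rev_cons cat_rcons.
  by rewrite rev_cons cat_rcons.
Qed.

(* A step [(m, n, v)] glues the vertex with ends [v] to the disk drawn so far,
   after rotating the two boundaries by [m] and [n]. *)
Fixpoint glue (steps : seq (nat * nat * seq nat)) (w : seq nat) :=
  if steps is (m, n, v) :: steps' then
    glue steps' (rev (foldl push [::] (rot m w ++ rot n v)))
  else w.

Lemma disk_glue V steps w :
  disk V w -> disk (V ++ [seq x.2 | x <- steps]) (glue steps w).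
Proof.
elim: steps V w => [|[[m n] v] steps IH] V w d /=; first by rewrite cats0.
rewrite -cat_rcons -cats1; apply: IH; apply: (@disk_push _ [::]).
exact: disk_union (disk_rot m d) (disk_rot n (disk_vertex v)).
Qed.

Definition frame (n : nat -> nat) : seq (nat * nat) :=
  [:: (rgt 2 0, lft 0 0); (rgt 4 0, lft 2 0); (rgt 0 0, lft 4 0);
      (lft 3 0, rgt 1 0); (lft 5 0, rgt 3 0); (lft 1 0, rgt 5 0);
      (lft 0 (n 0%N), lft 1 (n 1%N)); (rgt 1 (n 1%N), rgt 2 (n 2%N));
      (lft 2 (n 2%N), lft 3 (n 3%N)); (rgt 3 (n 3%N), rgt 4 (n 4%N));
      (lft 4 (n 4%N), lft 5 (n 5%N)); (rgt 5 (n 5%N), rgt 0 (n 0%N))].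

Definition box (n : nat -> nat) (k : nat) :=
  [:: lft k 0; rgt k 0; rgt k (n k); lft k (n k)].

(* Turns diagrams whose legs all end at level 1 into diagrams of the same shape
   whose leg k ends at level [n k]. *)
Definition raise (n : nat -> nat) (e : nat) : nat :=
  if (e < 12)%N then e else (12 * n ((e - 12)./2) + (e - 12))%N.

Lemma raise_lft0 n k : (k < 6)%N -> raise n (lft k 0) = lft k 0.
Proof. by rewrite /raise /lft => k6; rewrite ifT //; lia. Qed.

Lemma raise_rgt0 n k : (k < 6)%N -> raise n (rgt k 0) = rgt k 0.
Proof. by rewrite /raise /rgt => k6; rewrite ifT //; lia. Qed.

Lemma raise_lft1 n k : raise n (lft k 1) = lft k (n k).
Proof.
rewrite /raise /lft; case: ltnP => [|_]; first lia.
by rewrite (_ : (12 * 1 + 2 * k - 12)./2 = k)%N; lia.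
Qed.

Lemma raise_rgt1 n k : raise n (rgt k 1) = rgt k (n k).
Proof.
rewrite /raise /rgt; case: ltnP => [|_]; first lia.
by rewrite (_ : (12 * 1 + 2 * k + 1 - 12)./2 = k)%N; lia.
Qed.

Definition raiseE n := (raise_lft0 n, raise_rgt0 n, raise_lft1 n, raise_rgt1 n).

(** The residue modulo 12 records the leg and the side, and a positive top level stays distinct from
    level 0. *)
Lemma raise_inj n : (forall k, 0 < n k)%N ->
  {in [pred e | e < 24]%N &, injective (raise n)}.
Proof.
move=> n0 x y; rewrite !inE /raise => x24 y24.
have := n0 ((x - 12)./2); have := n0 ((y - 12)./2).
move: (n ((x - 12)./2)) (n ((y - 12)./2)) => a b a0 b0.
by case: (ltnP x 12); case: (ltnP y 12); lia.
Qed.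

Lemma raise_frame n :
  map (map_dvertex (raise n)) (points (frame (fun=> 1%N))) = points (frame n).
Proof. by rewrite /= !raiseE. Qed.

(** Planarity is computed once, for legs ending at level 1, and then transported along the renaming
    [raise n]. *)
Lemma disk_frame n : disk (map (box n) (iota 0 6) ++ pic (points (frame n))) [::].
Proof.
have d1 : disk (map (box (fun=> 1%N)) (iota 0 6) ++ pic (points (frame (fun=> 1%N)))) [::].
  (* Edges 0 to 11 are at the bottoms of the legs, 12 to 23 at the tops. The six boxes and twelve
     points are glued one by one, the legs of the inner tree first; the rotations bring common ends
     next to each other. *)
  have := @disk_glue _ [::
    (0, 0, [:: 0; 1; 13; 12]); (1, 1, [:: 5; 0]); (0, 1, [:: 4; 5; 17; 16]);
    (0, 1, [:: 9; 4]); (0, 1, [:: 8; 9; 21; 20]); (1, 0, [:: 1; 8]);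
    (2, 0, [:: 12; 14]); (0, 3, [:: 2; 3; 15; 14]); (1, 1, [:: 15; 17]);
    (0, 1, [:: 6; 3]); (0, 0, [:: 6; 7; 19; 18]); (1, 0, [:: 16; 18]);
    (1, 1, [:: 19; 21]); (0, 1, [:: 10; 7]); (0, 0, [:: 10; 11; 23; 22]);
    (4, 1, [:: 2; 11]); (3, 0, [:: 20; 22]); (0, 0, [:: 23; 13])]%N _ disk_nil.
  by apply: disk_perm.
have := disk_map (raise n) d1.
by rewrite map_cat -pic_map raise_frame /= !raiseE.
Qed.

(* The values [None], [Some false] and [Some true] of [o] stand for the twisted
   strands, the untwisted strands and the smoothed crossing. *)
Definition leg (n : nat -> nat) (k : nat) (o : option bool) : seq dvertex :=
  orient (odd k) match o with
    | None => twisted k 0 (n k)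
    | Some false => parallel k 0 (n k)
    | Some true => cut k 0 (n k)
  end.

(** For [k] beyond the length of [bs], [onth] returns [None], so the legs not yet expanded stay
    twisted. *)
Definition legs n (bs : seq bool) (ks : seq nat) := flatten [seq leg n k (onth bs k) | k <- ks].

Definition partial n bs := legs n bs (iota 0 6) ++ points (frame n).

Lemma disk_leg n k o : (0 < n k)%N -> disk (pic (leg n k o)) (box n k).
Proof.
move=> nk; rewrite /leg.
suff d D : disk (pic D) (box n k) -> disk (pic (orient (odd k) D)) (box n k).
  apply: d; case: o => [[]|]; [exact: disk_cut | exact: disk_parallel |].
  by have := disk_twisted k 0 (n k).-1; rewrite prednK.
by case: odd => //= d; have := @disk_reverse D [::]; rewrite !cats0; apply.
Qed.

Lemma disk_legs n bs ks W t : (forall k, 0 < n k)%N ->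
  disk (map (box n) ks ++ W) t -> disk (pic (legs n bs ks) ++ W) t.
Proof.
move=> n0; elim: ks W => //= k ks IH W d.
rewrite /legs /= pic_cat -catA.
have d1 := disk_subst (disk_leg (onth bs k) (n0 k)) d (perm_refl _).
have p : perm_eq (pic (leg n k (onth bs k)) ++ map (box n) ks ++ W)
    (map (box n) ks ++ pic (leg n k (onth bs k)) ++ W) by rewrite perm_catCA.
by apply: disk_perm (IH _ (disk_perm p d1)); rewrite perm_catCA.
Qed.

Lemma legs_rcons n bs b ks : (forall k, k \in ks -> k != size bs) ->
  legs n (rcons bs b) ks = legs n bs ks.
Proof.
move=> h; rewrite /legs; congr flatten; apply/eq_in_map => k /h kj.
congr leg; rewrite -cats1 onth_cat; case: ltnP => // jk.
rewrite [RHS]onth_default //.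
by rewrite onth_default //= subn_gt0 ltn_neqAle eq_sym kj.
Qed.

Lemma legs_cat n bs ks ks' : legs n bs (ks ++ ks') = legs n bs ks ++ legs n bs ks'.
Proof. by rewrite /legs map_cat flatten_cat. Qed.

(** The first leg still twisted is brought to the front of the code and expanded, all other legs
    forming the fixed rest of the diagram. *)
Lemma partial_step nabla n bs m : conway_polynomial nabla -> (forall k, 0 < n k)%N ->
  (size bs < 6)%N -> n (size bs) = m.+1.*2 -> link_diagram (partial n bs) ->
  [/\ link_diagram (partial n (rcons bs false)), link_diagram (partial n (rcons bs true)) &
   nabla (partial n bs) =
   nabla (partial n (rcons bs false)) + m.+1%:R * 'X * nabla (partial n (rcons bs true))].
Proof.
move=> Hn n0 j6 nj lD; set j := size bs in j6 nj *.
have iotaE : iota 0 6 = iota 0 j ++ j :: iota j.+1 (5 - j).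
  by rewrite -{1}(subnKC j6) addSnnS iotaD /= add0n subSS.
set A := legs n bs (iota 0 j); set B := legs n bs (iota j.+1 (5 - j)) ++ points (frame n).
have E0 : partial n bs = A ++ leg n j None ++ B.
  by rewrite /partial iotaE legs_cat -catA; congr (_ ++ _); rewrite /legs /= onth_default // -catA.
have E b : partial n (rcons bs b) = A ++ leg n j (Some b) ++ B.
  rewrite /partial iotaE legs_cat -catA legs_rcons; last first.
    by move=> k; rewrite mem_iota => /andP[_ kj]; rewrite neq_ltn kj.
  congr (_ ++ _); rewrite -cat1s legs_cat (@legs_rcons n bs b (iota j.+1 (5 - j))); last first.
    by move=> k; rewrite mem_iota => /andP[kj _]; rewrite neq_ltn kj orbT.
  by rewrite /legs /= -cats1 onth_cat ltnn subnn /= cats0 -catA.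
have p o : perm_eq (A ++ leg n j o ++ B) (leg n j o ++ A ++ B) by rewrite perm_catCA.
have p' o : perm_eq (leg n j o ++ A ++ B) (A ++ leg n j o ++ B) by rewrite perm_catCA.
(* In the drawing of the frame, tangles are inserted in the boxes before [j] and then in those after
   [j]; box [j] remains open. *)
have dC : disk (box n j :: pic (A ++ B)) [::].
  have := disk_frame n; rewrite iotaE map_cat -catA => /(disk_legs bs n0).
  have q V W : perm_eq (V ++ box n j :: W) (box n j :: V ++ W).
    by rewrite -[_ :: W]cat1s perm_catCA.
  move=> /(disk_perm (q _ _)) d.
  have q2 V W : perm_eq (box n j :: V ++ map (box n) (iota j.+1 (5 - j)) ++ W)
     (map (box n) (iota j.+1 (5 - j)) ++ box n j :: V ++ W).
    by rewrite perm_sym (perm_catCA _ [:: box n j]) perm_cons perm_catCA.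
  have q3 V W F : perm_eq (V ++ box n j :: W ++ F) (box n j :: W ++ V ++ F).
    by rewrite (perm_catCA V [:: box n j]) perm_cons perm_catCA.
  by have := disk_perm (q3 _ _ _) (disk_legs bs n0 (disk_perm (q2 _ _) d)); rewrite !pic_cat.
rewrite E0 !E in lD *.
rewrite (conway_perm Hn lD (p _)).
move/(link_diagram_perm (p _)): lD; rewrite {1 2}/leg nj => lD.
have [] := twisted_expansion_oriented Hn lD; first by rewrite /box nj in dC.
rewrite -nj => lp lc ->; split.
- exact: link_diagram_perm (p' (Some false)) lp.
- exact: link_diagram_perm (p' (Some true)) lc.
- congr (_ + _ * _); first exact: conway_perm Hn lp (p' (Some false)).
  exact: conway_perm Hn lc (p' (Some true)).
Qed.

Fixpoint expansion (f : seq bool -> {poly int}) (n : nat -> nat) (bs : seq bool) (ks : seq nat) :=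
  if ks is k :: ks' then
    expansion f n (rcons bs false) ks' + (n k)./2%:R * 'X * expansion f n (rcons bs true) ks'
  else f bs.

Lemma conway_expansion nabla n bs m : conway_polynomial nabla ->
  (forall k, 0 < n k)%N -> (forall k, ~~ odd (n k)) ->
  (size bs + m = 6)%N -> link_diagram (partial n bs) ->
  nabla (partial n bs) = expansion (fun bs => nabla (partial n bs)) n bs (iota (size bs) m).
Proof.
move=> Hn n0 n_even; elim: m bs => [|m IH] bs //= bs6 lD.
have nE : n (size bs) = ((n (size bs))./2.-1).+1.*2.
  have := n0 (size bs); have := n_even (size bs); lia.
have [] := partial_step Hn n0 _ nE lD; first lia.
move=> lf lt ->; rewrite (IH _ _ lf) ?(IH _ _ lt) ?size_rcons ?addSnnS //.
by rewrite prednK //; have := n0 (size bs); have := n_even (size bs); lia.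
Qed.

(** * Evaluation of the 64 smoothings *)

Definition unpoint (v : dvertex) : nat * nat := if v is DPoint i o then (i, o) else (0, 0)%N.

(* The bits tell which of the legs 0, ..., 5 are cut. *)
Definition one_circle (bs : seq bool) : bool :=
  if bs is [:: p; a; q; b; r; c] then
    match (p + q + r)%N, (a + b + c)%N with
    | 0, 0 | 2, 2 => true
    | 1, 1 => [|| p && a, p && c, q && a, q && b, r && b | r && c]
    | _, _ => false
    end
  else false.

(** The single circles match the monomials of the formula: no cut; one leg of each tree, adjacent on
    the circle; two legs of each tree. The second clause excludes the junk value of [unpoint], and
    the fuel 24 is the number of arcs. *)
Lemma smoothing_is_circle (p a q b r c : bool) :
  let bs := [:: p; a; q; b; r; c] in let D := partial (fun=> 1%N) bs in
  [&& coherent D, points (map unpoint D) == D, all (fun e => e < 24)%N (all_ins D) &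
      is_circle 24 (map unpoint D) == Some (one_circle bs)].
Proof. by move: p a q b r c; do 6!case; vm_compute. Qed.

Lemma raise_leg n k b : (k < 6)%N ->
  map (map_dvertex (raise n)) (leg (fun=> 1%N) k (Some b)) = leg n k (Some b).
Proof.
by move=> k6; rewrite /leg; case: b; case: odd; rewrite /= !raiseE.
Qed.

Lemma raise_partial n bs : size bs = 6%N ->
  map (map_dvertex (raise n)) (partial (fun=> 1%N) bs) = partial n bs.
Proof.
case: bs => [|p [|a [|q [|b [|r [|c [|]]]]]]] // _.
by rewrite /partial map_cat raise_frame /legs /= !map_cat !raise_leg.
Qed.

(** A leg without crossings has the same shape at any length, so the diagram is a renaming of the
    one evaluated by [smoothing_is_circle]. *)
Lemma conway_smoothing nabla n p a q b r c : conway_polynomial nabla ->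
  (forall k, 0 < n k)%N ->
  nabla (partial n [:: p; a; q; b; r; c]) = (one_circle [:: p; a; q; b; r; c])%:R.
Proof.
move=> Hn n0; rewrite -raise_partial //.
have /and4P[cD /eqP pD /allP D24 /eqP eD] := smoothing_is_circle p a q b r c.
set D := partial _ _ in cD pD D24 eD *.
have lD : link_diagram D by rewrite -pD; apply: link_diagram_points; rewrite pD.
have f_inj : {in all_ins D &, injective (raise n)}.
  by move=> x y /D24 x24 /D24 y24; apply: (raise_inj n0).
rewrite -(conway_invariant Hn lD (link_diagram_map f_inj lD) (move_rename f_inj)).
by rewrite -pD; apply: (conway_points Hn _ eD); rewrite pD.
Qed.

(** * The two orientations *)

(* The crossing [Cross a b c d], its strands running from a to c iff [x] holds
   and from b to d iff [y] holds. *)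
Definition oriented_cross (x y : bool) (a b c d : nat) : dvertex :=
  match x, y with
  | true, false => DCross true d a c b
  | false, true => DCross true b c a d
  | true, true => DCross false a b d c
  | false, false => DCross false c d b a
  end.

Definition oriented_point (s : bool) (a b : nat) : dvertex :=
  if s then DPoint a b else DPoint b a.

Lemma same_vertex_cross v a b c d : same_vertex (forget v) (Cross a b c d) ->
  exists x y, v = oriented_cross x y a b c d.
Proof.
case: v => [[] l r l' r'|i o] //= /orP[] /eqP[-> -> -> ->].
- by exists true, false.
- by exists false, true.
- by exists true, true.
- by exists false, false.
Qed.

Lemma same_vertex_point v a b : same_vertex (forget v) (Point a b) ->
  exists s, v = oriented_point s a b.
Proof.
case: v => [[] l r l' r'|i o] //= /orP[] /eqP[-> ->]; first by exists true.
by exists false.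
Qed.

(* Along a leg the two strands alternate as the upper one. *)
Definition leg_cross k (x y : bool) (i : nat) : dvertex :=
  oriented_cross (if odd i then y else x) (if odd i then x else y)
    (lft k i) (rgt k i) (rgt k i.+1) (lft k i.+1).

(** Consecutive crossings share two edges. Were a strand to change direction on one of them, that
    edge would have two initial or two final ends; so the directions at the lowest crossing
    determine the leg. *)
Lemma codes_leg k L j m :
  codes L [seq Cross (lft k i) (rgt k i) (rgt k i.+1) (lft k i.+1) | i <- iota j m.+1] ->
  uniq (all_ins L) -> uniq (all_outs L) ->
  exists x y, L = [seq leg_cross k x y i | i <- iota j m.+1].
Proof.
elim: m j L => [|m IH] j [|v L] //=.
  case: L => [|? ?]; rewrite /codes /= ?andbF // andbT => /same_vertex_cross[x [y ->]] _ _.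
  exists (if odd j then y else x), (if odd j then x else y).
  by rewrite /leg_cross; case: odd.
rewrite /codes [map _ _]/= [all2 _ _ _]/= => /andP[/same_vertex_cross[x [y ->]] cL] ui uo.
have [] := IH j.+1 L cL.
- by move: ui; rewrite /all_ins /= cat_uniq => /and3P[].
- by move: uo; rewrite /all_outs /= cat_uniq => /and3P[].
move=> x1 [y1 EL]; exists x1, y1; rewrite EL; congr (_ :: _).
move: ui uo; rewrite EL /all_ins /all_outs /= /leg_cross /=.
by clear; case: odd x y x1 y1 => -[] [] [] [] //=; rewrite !inE !eqxx ?orbT ?andbF.
Qed.

Definition occurs (b : bool) (e : nat) (D : seq dvertex) : bool :=
  e \in if b then all_ins D else all_outs D.

Lemma uniq_flatten_nth (T : eqType) (ss : seq (seq T)) i j e :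
  uniq (flatten ss) -> e \in nth [::] ss i -> e \in nth [::] ss j -> i = j.
Proof.
have mem (s : seq (seq T)) k : e \in nth [::] s k -> e \in flatten s.
  by elim: s k => [|t s IH] [|k] //= ek; rewrite mem_cat ?ek // (IH k) ?orbT.
elim: ss i j => [|s ss IH] [|i] [|j] //=; rewrite cat_uniq => /and3P[_ /hasPn h u].
- by move=> es /mem /h /=; rewrite es.
- by move=> /mem /h /= /negbTE ->.
- by move=> ei ej; congr _.+1; apply: IH ei ej.
Qed.

(** An edge has one initial and one final end, so if it joins two different pieces, it leaves one
    and enters the other. *)
Lemma occurs_neq (Ds : seq (seq dvertex)) b b' e i j : coherent (flatten Ds) ->
  i != j -> occurs b e (nth [::] Ds i) -> occurs b' e (nth [::] Ds j) -> b' = ~~ b.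
Proof.
move=> cD ij; have := coherent_uniq_ins cD; have := coherent_uniq_outs cD.
have all_in : all_ins (flatten Ds) = flatten (map all_ins Ds).
  by elim: (Ds) => //= D s IH; rewrite all_ins_cat IH.
have all_out : all_outs (flatten Ds) = flatten (map all_outs Ds).
  by elim: (Ds) => //= D s IH; rewrite all_outs_cat IH.
rewrite all_in all_out => uo ui.
have nthm (f : seq dvertex -> seq nat) k : f [::] = [::] -> f (nth [::] Ds k) = nth [::] (map f Ds) k.
  by move=> f0; elim: (Ds) k => [|D s IH] [|k] //=.
rewrite /occurs; case: b; case: b' => //; rewrite !nthm // => ei ej.
- by have := uniq_flatten_nth ui ei ej => /eqP; rewrite (negbTE ij).
- by have := uniq_flatten_nth uo ei ej => /eqP; rewrite (negbTE ij).
Qed.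

Lemma coherent_piece (Ds : seq (seq dvertex)) i : coherent (flatten Ds) ->
  uniq (all_ins (nth [::] Ds i)) /\ uniq (all_outs (nth [::] Ds i)).
Proof.
move=> cD; have := coherent_uniq_ins cD; have := coherent_uniq_outs cD.
elim: Ds i {cD} => [|D Ds IH] [|i] //=; rewrite all_ins_cat all_outs_cat !cat_uniq.
  by move=> /and3P[-> _ _] /and3P[-> _ _].
by move=> /and3P[_ _ uo] /and3P[_ _ ui]; apply: IH.
Qed.

(** [x] and [y] tell whether the strands at [lft k 0] and [rgt k 0] climb. After an even number of
    half twists each strand is back on its own side, so its upper end has the opposite role. *)
Lemma occurs_leg k x y m : let L := [seq leg_cross k x y i | i <- iota 0 m.+1.*2] in
  [/\ occurs x (lft k 0) L, occurs y (rgt k 0) L,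
      occurs (~~ x) (lft k m.+1.*2) L & occurs (~~ y) (rgt k m.+1.*2) L].
Proof.
move=> L.
have first_in : leg_cross k x y 0 \in L by rewrite mem_head.
have last_in : leg_cross k x y m.*2.+1 \in L.
  by apply: map_f; rewrite mem_iota /= doubleS.
have occ b e v : v \in L -> e \in (if b then ins v else outs v) -> occurs b e L.
  by move=> vL; rewrite /occurs; case: b => ev; apply/flattenP;
    [exists (ins v) | exists (outs v)] => //; apply: map_f.
by split; [apply: occ first_in _|apply: occ first_in _|apply: occ last_in _|apply: occ last_in _];
  rewrite /leg_cross /= ?odd_double /= ?doubleS; clear; case: x; case: y;
  rewrite /= !inE eqxx ?orbT.
Qed.

Lemma occurs_point v s a b : v = oriented_point s a b ->
  occurs s a [:: v] /\ occurs (~~ s) b [:: v].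
Proof. by move=> ->; case: s; rewrite /occurs /all_ins /all_outs /= !inE !eqxx. Qed.

Lemma occurs_oriented_point (Ds : seq (seq dvertex)) v s a b x y i j k :
  coherent (flatten Ds) -> v = oriented_point s a b -> nth [::] Ds k = [:: v] ->
  i != k -> j != k -> occurs x a (nth [::] Ds i) -> occurs y b (nth [::] Ds j) ->
  s = ~~ x /\ y = ~~ x.
Proof.
move=> cD /occurs_point[oa ob] Dk ik jk xa yb; rewrite -Dk in oa ob.
have sx := occurs_neq cD ik xa oa; have := occurs_neq cD jk yb ob.
by rewrite sx => /negb_inj ->.
Qed.

Lemma codes_catP D U U' : codes D (U ++ U') ->
  exists D1 D2, [/\ D = D1 ++ D2, codes D1 U & codes D2 U'].
Proof.
elim: U D => [|u U IH] D; first by exists [::], D.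
case: D => //= v D; rewrite /codes /= => /andP[vu /IH[D1 [D2 [-> c1 c2]]]].
by exists (v :: D1), D2; rewrite /= vu.
Qed.

Lemma codes_consP D u U : codes D (u :: U) ->
  exists v D', [/\ D = v :: D', same_vertex (forget v) u & codes D' U].
Proof. by case: D => //= v D /andP[vu cD]; exists v, D. Qed.

Lemma leg_cross_antiparallel k m x y : y = ~~ x ->
  [seq leg_cross k x y i | i <- iota 0 m] = orient y (twisted k 0 m).
Proof.
by move=> ->; case: x => /=; rewrite /reverse /twisted -?map_comp; apply: eq_map => i /=;
  rewrite /leg_cross /pos_cross; case: odd.
Qed.

Lemma twistE k (n : int) : 0 < n -> twist k n =
  [seq Cross (lft k i) (rgt k i) (rgt k i.+1) (lft k i.+1) | i <- iota 0 `|n|].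
Proof. by rewrite /twist => ->. Qed.

(** Each leg has two unknown directions, one for each strand. The twelve points identify or oppose
    them, and this leaves a single free bit. *)
Lemma orientation_K p q r a b c D :
  0 < p -> 0 < q -> 0 < r -> 0 < a -> 0 < b -> 0 < c ->
  ~~ odd `|p| -> ~~ odd `|q| -> ~~ odd `|r| ->
  ~~ odd `|a| -> ~~ odd `|b| -> ~~ odd `|c| ->
  orientation_of D (K p q r a b c) ->
  exists s, D = orient s (dK p q r a b c).
Proof.
move=> p0 q0 r0 a0 b0 c0 hp hq hr ha hb hc /andP[cD].
have half (n : int) : 0 < n -> ~~ odd `|n| -> exists m, `|n|%N = m.+1.*2.
  by move=> n0 hn; exists (`|n|./2.-1)%N; lia.
rewrite /K !twistE //.
have [mp Ep] := half p p0 hp; have [mq Eq] := half q q0 hq; have [mr Er] := half r r0 hr.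
have [ma Ea] := half a a0 ha; have [mb Eb] := half b b0 hb; have [mc Ec] := half c c0 hc.
rewrite /dK !dtwist_twisted // Ep Eq Er Ea Eb Ec.
move=> /codes_catP[L0 [D1 [E0 c0']]].
move=> /codes_catP[L1 [D2 [E1 c1']]].
move=> /codes_catP[L2 [D3 [E2 c2']]].
move=> /codes_catP[L3 [D4 [E3 c3']]].
move=> /codes_catP[L4 [D5 [E4 c4']]].
move=> /codes_catP[L5 [D6 [E5 c5']]].
move=> /codes_consP[v0 [F0 [G0 /same_vertex_point[s0 w0]]]].
move=> /codes_consP[v1 [F1 [G1 /same_vertex_point[s1 w1]]]].
move=> /codes_consP[v2 [F2 [G2 /same_vertex_point[s2 w2]]]].
move=> /codes_consP[v3 [F3 [G3 /same_vertex_point[s3 w3]]]].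
move=> /codes_consP[v4 [F4 [G4 /same_vertex_point[s4 w4]]]].
move=> /codes_consP[v5 [F5 [G5 /same_vertex_point[s5 w5]]]].
move=> /codes_consP[v6 [F6 [G6 /same_vertex_point[s6 w6]]]].
move=> /codes_consP[v7 [F7 [G7 /same_vertex_point[s7 w7]]]].
move=> /codes_consP[v8 [F8 [G8 /same_vertex_point[s8 w8]]]].
move=> /codes_consP[v9 [F9 [G9 /same_vertex_point[s9 w9]]]].
move=> /codes_consP[v10 [F10 [G10 /same_vertex_point[s10 w10]]]].
move=> /codes_consP[v11 [F11 [G11 /same_vertex_point[s11 w11]]]].
case: F11 G11 => // G11 _.
rewrite {}E0 {}E1 {}E2 {}E3 {}E4 {}E5 {}G0 {}G1 {}G2 {}G3 {}G4 {}G5 in cD *.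
rewrite {}G6 {}G7 {}G8 {}G9 {}G10 {}G11 in cD *.
(* Pieces 0 to 5 are the legs and 6 to 17 the points; the indices passed to [occurs_oriented_point]
   are the two legs that a point joins and the point itself. *)
set Ds := [:: L0; L1; L2; L3; L4; L5; [:: v0]; [:: v1]; [:: v2]; [:: v3]; [:: v4]; [:: v5];
  [:: v6]; [:: v7]; [:: v8]; [:: v9]; [:: v10]; [:: v11]].
have {}cD : coherent (flatten Ds) by [].
have [x0 [y0 M0]] : exists x y, L0 = [seq leg_cross 0 x y i | i <- iota 0 mp.+1.*2].
  by have [ui uo] := coherent_piece 0 cD; rewrite doubleS in c0' *; apply: codes_leg c0' ui uo.
have [x1 [y1 M1]] : exists x y, L1 = [seq leg_cross 1 x y i | i <- iota 0 ma.+1.*2].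
  by have [ui uo] := coherent_piece 1 cD; rewrite doubleS in c1' *; apply: codes_leg c1' ui uo.
have [x2 [y2 M2]] : exists x y, L2 = [seq leg_cross 2 x y i | i <- iota 0 mq.+1.*2].
  by have [ui uo] := coherent_piece 2 cD; rewrite doubleS in c2' *; apply: codes_leg c2' ui uo.
have [x3 [y3 M3]] : exists x y, L3 = [seq leg_cross 3 x y i | i <- iota 0 mb.+1.*2].
  by have [ui uo] := coherent_piece 3 cD; rewrite doubleS in c3' *; apply: codes_leg c3' ui uo.
have [x4 [y4 M4]] : exists x y, L4 = [seq leg_cross 4 x y i | i <- iota 0 mr.+1.*2].
  by have [ui uo] := coherent_piece 4 cD; rewrite doubleS in c4' *; apply: codes_leg c4' ui uo.
have [x5 [y5 M5]] : exists x y, L5 = [seq leg_cross 5 x y i | i <- iota 0 mc.+1.*2].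
  by have [ui uo] := coherent_piece 5 cD; rewrite doubleS in c5' *; apply: codes_leg c5' ui uo.
have [lb0 rb0 lt0 rt0] := occurs_leg 0 x0 y0 mp; rewrite -M0 in lb0 rb0 lt0 rt0.
have [lb1 rb1 lt1 rt1] := occurs_leg 1 x1 y1 ma; rewrite -M1 in lb1 rb1 lt1 rt1.
have [lb2 rb2 lt2 rt2] := occurs_leg 2 x2 y2 mq; rewrite -M2 in lb2 rb2 lt2 rt2.
have [lb3 rb3 lt3 rt3] := occurs_leg 3 x3 y3 mb; rewrite -M3 in lb3 rb3 lt3 rt3.
have [lb4 rb4 lt4 rt4] := occurs_leg 4 x4 y4 mr; rewrite -M4 in lb4 rb4 lt4 rt4.
have [lb5 rb5 lt5 rt5] := occurs_leg 5 x5 y5 mc; rewrite -M5 in lb5 rb5 lt5 rt5.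
have [A0 B0] := @occurs_oriented_point Ds _ _ _ _ _ _ 0 2 6 cD w0 erefl isT isT lb0 rb2.
have [A1 B1] := @occurs_oriented_point Ds _ _ _ _ _ _ 2 4 7 cD w1 erefl isT isT lb2 rb4.
have [A2 B2] := @occurs_oriented_point Ds _ _ _ _ _ _ 4 0 8 cD w2 erefl isT isT lb4 rb0.
have [A3 B3] := @occurs_oriented_point Ds _ _ _ _ _ _ 1 3 9 cD w3 erefl isT isT rb1 lb3.
have [A4 B4] := @occurs_oriented_point Ds _ _ _ _ _ _ 3 5 10 cD w4 erefl isT isT rb3 lb5.
have [A5 B5] := @occurs_oriented_point Ds _ _ _ _ _ _ 5 1 11 cD w5 erefl isT isT rb5 lb1.
have [A6 B6] := @occurs_oriented_point Ds _ _ _ _ _ _ 0 1 12 cD w6 erefl isT isT lt0 lt1.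
have [A7 B7] := @occurs_oriented_point Ds _ _ _ _ _ _ 1 2 13 cD w7 erefl isT isT rt1 rt2.
have [A8 B8] := @occurs_oriented_point Ds _ _ _ _ _ _ 2 3 14 cD w8 erefl isT isT lt2 lt3.
have [A9 B9] := @occurs_oriented_point Ds _ _ _ _ _ _ 3 4 15 cD w9 erefl isT isT rt3 rt4.
have [A10 B10] := @occurs_oriented_point Ds _ _ _ _ _ _ 4 5 16 cD w10 erefl isT isT lt4 lt5.
have [A11 B11] := @occurs_oriented_point Ds _ _ _ _ _ _ 5 0 17 cD w11 erefl isT isT rt5 rt0.
have [t [X0 Y0 X1 Y1 [X2 Y2 X3 Y3 [X4 Y4 X5 Y5]]]] : exists t,
    [/\ x0 = t, y0 = ~~ t, x1 = ~~ t, y1 = t &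
    [/\ x2 = t, y2 = ~~ t, x3 = ~~ t, y3 = t &
    [/\ x4 = t, y4 = ~~ t, x5 = ~~ t & y5 = t]]].
  exists x0; move: B0 B1 B2 B3 B4 B5 B6 B7 B8 B9 B10 B11; clear.
  move=> -> -> -> -> -> ->; case: x0; case: y1; case: x2; case: y3; case: x4; by case: y5.
(* In [dK] the strand at [lft 0 0] climbs, which is the case [t = true]. *)
exists (~~ t).
rewrite w0 w1 w2 w3 w4 w5 w6 w7 w8 w9 w10 w11.
rewrite A0 A1 A2 A3 A4 A5 A6 A7 A8 A9 A10 A11 M0 M1 M2 M3 M4 M5.
rewrite X0 Y0 X1 Y1 X2 Y2 X3 Y3 X4 Y4 X5 Y5 !leg_cross_antiparallel ?negbK //.
clear; do 6![move: (twisted _ 0 _) => ?].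
by case: t; rewrite /= ?reverse_cat ?reverseK /= ?reverseK.
Qed.

(** * Assembly of the formula *)

Lemma conway_dK nabla (p q r a b c : int) : conway_polynomial nabla ->
  0 < p -> 0 < q -> 0 < r -> 0 < a -> 0 < b -> 0 < c ->
  ~~ odd `|p| -> ~~ odd `|q| -> ~~ odd `|r| ->
  ~~ odd `|a| -> ~~ odd `|b| -> ~~ odd `|c| ->
  let P : {poly int} := (`|p|./2)%:R in let Q := (`|q|./2)%:R in let R := (`|r|./2)%:R in
  let A := (`|a|./2)%:R in let B := (`|b|./2)%:R in let C := (`|c|./2)%:R in
  nabla (dK p q r a b c) =
  (P * Q + P * R + Q * R) * (A * B + A * C + B * C) * 'X ^+ 4
  + (P * A + P * C + Q * A + Q * B + R * B + R * C) * 'X ^+ 2 + 1.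
Proof.
move=> Hn p0 q0 r0 a0 b0 c0 hp hq hr ha hb hc P Q R A B C.
(* The default 2 makes [n k] positive and even for every [k]. *)
pose n := nth 2%N [:: `|p|; `|a|; `|q|; `|b|; `|r|; `|c|]%N.
have n0 k : (0 < n k)%N.
  by rewrite /n; do 6?[case: k => [|k] /=; first lia]; rewrite nth_nil.
have n_even k : ~~ odd (n k).
  by rewrite /n; do 6?[case: k => [|k] //=]; rewrite nth_nil.
have E : dK p q r a b c = partial n [::].
  by rewrite /dK !dtwist_twisted // /partial /legs /leg /n /= -!catA.
have lD : link_diagram (partial n [::]).
  split; last by rewrite -/(pic _) pic_cat; apply: disk_legs n0 (disk_frame n).
  by rewrite -E; case/andP: (dK_orientation hp hq hr ha hb hc).
rewrite E (@conway_expansion nabla n [::] 6 Hn n0 n_even erefl lD) /=.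
rewrite !(conway_smoothing _ _ _ _ _ _ Hn n0) /= -/P -/Q -/R -/A -/B -/C.
ring.
Qed.

Theorem lemma4p2 (nabla : seq dvertex -> {poly int}) (p q r a b c : int)
    (D : seq dvertex) :
  conway_polynomial nabla ->
  0 < p -> 0 < q -> 0 < r -> 0 < a -> 0 < b -> 0 < c ->
  (2 %| p)%Z -> (2 %| q)%Z -> (2 %| r)%Z ->
  (2 %| a)%Z -> (2 %| b)%Z -> (2 %| c)%Z ->
  orientation_of D (K p q r a b c) ->
  map_poly (intr : int -> rat) (nabla D) =
    ((p * q + p * r + q * r) * (a * b + a * c + b * c))%:~R
      *: (2^-1 *: 'X) ^+ 4
    + (p * a + p * c + q * a + q * b + r * b + r * c)%:~R
      *: (2^-1 *: 'X) ^+ 2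
    + 1.
Proof.
move=> Hn p0 q0 r0 a0 b0 c0 dp dq dr da db dc DK.
have even (n : int) : (2 %| n)%Z -> ~~ odd `|n|%N by lia.
have [{DK} s ->] := orientation_K p0 q0 r0 a0 b0 c0 (even _ dp) (even _ dq) (even _ dr)
  (even _ da) (even _ db) (even _ dc) DK.
(* The reversed diagram is handled by changing the polynomial instead: [nabla \o reverse] satisfies
   the same axioms. *)
have -> : nabla (orient s (dK p q r a b c)) = (if s then nabla \o reverse else nabla) (dK p q r a b c).
  by case: s.
rewrite conway_dK ?even //; last by case: s => //; apply: conway_reverse.
have half (n : int) : 0 < n -> (2 %| n)%Z -> exists m : nat, n = 2 * m%:Z.
  by move=> n0 dn; exists (`|n|./2)%N; lia.
have halfK (m : nat) : (`|(2 * m%:Z)%R|./2)%N = m by lia.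
have [P ->] := half p p0 dp; have [Q ->] := half q q0 dq; have [R ->] := half r r0 dr.
have [A ->] := half a a0 da; have [B ->] := half b b0 db; have [C ->] := half c c0 dc.
rewrite !halfK !scaler_int -![(2^-1 *: 'X) ^+ _ *~ _]mulrzl.
set Y : {poly rat} := 2^-1 *: 'X.
(* With every label equal to twice its half and ['X] equal to [2 * Y], the powers of 2 agree: four
   labels against [Y ^+ 4], two against [Y ^+ 2]. *)
have EX : 'X = 2%:R * Y.
  by rewrite /Y -scalerAr mulr_natl -scaler_nat scalerA mulVf ?scale1r.
rewrite !(rmorphXn, rmorphD, rmorphM, rmorph_nat, rmorph1) /= map_polyX EX -!pmulrn.
ring.
Qed.
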